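(* Let $s\in\frac12\mathbb{N}$ with $s\ge1$. The sequence of differential operators on $\mathbb{R}^3$ $$\mathcal{S}_{2s-2}\xrightarrow{\ \mathbf{t}_{2s-2}\ }\mathcal{S}_{2s}\xrightarrow{\ \mathcal{G}_{2s}\ }\mathcal{S}_{2s}\xrightarrow{\ \mathbf{d}_{2s}\ }\mathcal{S}_{2s-2}$$ is an elliptic complex; that is, $\mathcal{G}_{2s}\mathbf{t}_{2s-2}=0$, $\mathbf{d}_{2s}\mathcal{G}_{2s}=0$, and for each nonzero real covector $\xi$ the associated sequence of principal symbols $S_{2s-2}\xrightarrow{\sigma_\xi(\mathbf{t}_{2s-2})}S_{2s}\xrightarrow{\sigma_\xi(\mathcal{G}_{2s})}S_{2s}\xrightarrow{\sigma_\xi(\mathbf{d}_{2s})}S_{2s-2}$ is exact (at the two middle terms).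
   Context: Spinor conventions on $\mathbb{R}^3$: indices $A,B,\dots$ take values $0,1$; $\epsilon_{AB}$ is antisymmetric with $\epsilon_{01}=\epsilon^{01}=1$; $\psi^A=\epsilon^{AB}\psi_B$, $\psi_B=\psi^A\epsilon_{AB}$; parentheses around indices denote total symmetrization. $S_k$ is the (trivial) bundle over $\mathbb{R}^3$ of totally symmetric complex spinors $\phi_{A_1\dots A_k}$, $\mathcal{S}_k$ its smooth sections ($S_0$: complex scalars). In a constant spin frame and Cartesian coordinates the spatial spinor derivative $D_{AB}=D_{BA}$ is $D_{00}=-\frac1{\sqrt2}(\partial_1-i\partial_2)$, $D_{11}=\frac1{\sqrt2}(\partial_1+i\partial_2)$, $D_{01}=\frac1{\sqrt2}\partial_3$; $D_A{}^B=\epsilon^{BC}D_{AC}$. $\Delta=D_{AB}D^{AB}$, acting componentwise ($\Delta_k$ on valence-$k$ spinors). Operators: $(\mathbf{d}_k\phi)_{A_1\dots A_{k-2}}=D^{A_{k-1}A_k}\phi_{A_1\dots A_k}$ (divergence), $(\mathbf{t}_k\phi)_{A_1\dots A_{k+2}}=D_{(A_1A_2}\phi_{A_3\dots A_{k+2})}$ (twistor operator), and $$(\mathcal{G}_k\phi)_{A_1\dots A_k}=\sum_{n=0}^{\lfloor\frac{k-1}2\rfloor}\binom{k}{2n+1}(-2)^{-n}\underbrace{D_{(A_1}{}^{B_1}\cdots D_{A_{k-2n-1}}{}^{B_{k-2n-1}}}_{k-2n-1}(\Delta_k^n\phi)_{A_{k-2n}\dots A_k)B_1\dots B_{k-2n-1}}.$$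 The symbol $\sigma_\xi$ is obtained by replacing $D_{AB}$ by $\xi_{AB}$ (i.e. $\partial_i$ by $\xi_i\in\mathbb{R}$). *)

(* Defs.v *)
From HB Require Import structures.
From mathcomp Require Import all_boot all_order all_algebra all_fingroup.
From mathcomp Require Import complex.
From mathcomp Require Import all_classical all_reals all_analysis.

Set Implicit Arguments.
Unset Strict Implicit.
Unset Printing Implicit Defensive.

Import Order.TTheory GRing.Theory Num.Theory.
Import numFieldNormedType.Exports.

Local Open Scope classical_set_scope.
Local Open Scope ring_scope.
Local Open Scope complex_scope.

(* Component families of valence-k spinors, with components in V: V = R[i] for
   spinors at a point, V = (R^3 -> R[i]) for spinor fields in a constant
   frame. *)
Definition spinor (V : Type) (k : nat) := {ffun k.-tuple 'I_2 -> V}.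

Definition permute_tuple (k : nat) (T : Type) (s : 'S_k) (A : k.-tuple T) :
  k.-tuple T := [tuple tnth A (s i) | i < k].

Definition symmetric_spinor (V : Type) (k : nat) (phi : spinor V k) : Prop :=
  forall (s : 'S_k) (A : k.-tuple 'I_2), phi (permute_tuple s A) = phi A.

(* epsilon_{AB}, which has the same components as epsilon^{AB} *)
Definition eps (K : pzRingType) (A B : 'I_2) : K :=
  (A < B)%N%:R - (B < A)%N%:R.

(* The operators are formal expressions in three endomorphisms pd i of a complex
   vector space V. Taking for pd i the partial derivative along the i-th
   coordinate gives the differential operator; taking multiplication by xi_i on
   V = R[i] gives its symbol. As the expressions are homogeneous in the pd i,
   this is the principal symbol. Coordinates are numbered from 0. *)
Section SpinorOperators.
Variables (R : realType) (V : lmodType R[i]) (pd : 'I_3 -> V -> V).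

(* D_{AB} *)
Definition Ddown (A B : 'I_2) (f : V) : V :=
  ((Num.sqrt (2 : R))%:C)^-1 *:
  (if A != B then pd 2 f
   else if A == 0 then - (pd 0 f - 'i%C *: pd 1 f)
   else pd 0 f + 'i%C *: pd 1 f).

(* D^{AB} = eps^{AC} eps^{BE} D_{CE} *)
Definition Dup (A B : 'I_2) (f : V) : V :=
  \sum_(C : 'I_2) \sum_(E : 'I_2) (eps R[i] A C * eps R[i] B E) *: Ddown C E f.

(* D_A^B = eps^{BC} D_{AC} *)
Definition Dmix (A B : 'I_2) (f : V) : V :=
  \sum_(C : 'I_2) eps R[i] B C *: Ddown A C f.

(* D_{AB} D^{AB}, which is minus the usual sum of second derivatives *)
Definition Lap (f : V) : V :=
  \sum_(A : 'I_2) \sum_(B : 'I_2) Ddown A B (Dup A B f).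

Definition symmetrize (k : nat) (phi : spinor V k) : spinor V k :=
  [ffun A => (k`!%:R : R[i])^-1 *: \sum_(s : 'S_k) phi (permute_tuple s A)].

Definition divergence (k : nat) (phi : spinor V k.+2) : spinor V k :=
  [ffun A : k.-tuple 'I_2 => \sum_(P : 'I_2) \sum_(Q : 'I_2)
     Dup P Q (phi [tuple of rcons (rcons A P) Q])].

Definition twistor (k : nat) (phi : spinor V k) : spinor V k.+2 :=
  symmetrize [ffun A : k.+2.-tuple 'I_2 =>
     Ddown (thead A) (thead [tuple of behead A])
           (phi [tuple of behead (behead A)])].

(* The multi-index A_{m+1} ... A_k B_1 ... B_m *)
Definition tail_cat (k m : nat) (lemk : (m <= k)%N)
    (A : k.-tuple 'I_2) (B : m.-tuple 'I_2) : k.-tuple 'I_2 :=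
  tcast (subnK lemk) [tuple of drop m A ++ B].

(* D_{A_1}^{B_1} ... D_{A_m}^{B_m} *)
Definition Dmix_iter (As Bs : seq 'I_2) (f : V) : V :=
  foldr (fun ab g => Dmix ab.1 ab.2 g) f (zip As Bs).

(* The summand of G_k at n, without its coefficient and before
   symmetrization *)
Definition Gterm (k n : nat) (phi : spinor V k) : spinor V k :=
  let m := (k - n.*2.+1)%N in
  [ffun A : k.-tuple 'I_2 => \sum_(B : m.-tuple 'I_2)
     Dmix_iter (take m A) B
       (iter n Lap (phi (tail_cat (leq_subr n.*2.+1 k) A B)))].

(* The numerator k - 1 is truncated at k = 0, where the extra summand has
   coefficient 'C(0, 1) = 0. *)
Definition calG (k : nat) (phi : spinor V k) : spinor V k :=
  \sum_(n < (k.-1)./2.+1)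
    ('C(k, n.*2.+1)%:R * (-2) ^- n : R[i]) *: symmetrize (Gterm n phi).

End SpinorOperators.

Section Fields.
Variable R : realType.

Definition coord_vec (i : 'I_3) : 'rV[R]_3 := delta_mx 0 i.

Definition real_partial (i : 'I_3) (f : 'rV[R]_3 -> R) : 'rV[R]_3 -> R :=
  fun x => 'D_(coord_vec i) f x.

Definition real_smooth (f : 'rV[R]_3 -> R) : Prop :=
  forall l : seq 'I_3, let g := foldr real_partial f l in
    continuous g /\ forall (i : 'I_3) (x : 'rV[R]_3), derivable g x (coord_vec i).

Definition partial (i : 'I_3) (f : 'rV[R]_3 -> R[i]^o) : 'rV[R]_3 -> R[i]^o :=
  fun x => real_partial i (@complex.Re R \o f) x +i* real_partial i (@complex.Im R \o f) x.

Definition smooth (f : 'rV[R]_3 -> R[i]^o) : Prop :=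
  real_smooth (@complex.Re R \o f) /\ real_smooth (@complex.Im R \o f).

Definition Sfibre (k : nat) : set (spinor R[i]^o k) :=
  [set phi | symmetric_spinor phi].

(* A section of the trivial bundle S_k, given by its components. *)
Definition Ssections (k : nat) : set (spinor ('rV[R]_3 -> R[i]^o) k) :=
  [set phi | symmetric_spinor phi /\ forall A, smooth (phi A)].

Definition xi_mul (xi : 'rV[R]_3) (i : 'I_3) (c : R[i]^o) : R[i]^o :=
  (xi 0 i)%:C * c.

Definition t_op (k : nat) := @twistor R ('rV[R]_3 -> R[i]^o) partial k.
Definition G_op (k : nat) := @calG R ('rV[R]_3 -> R[i]^o) partial k.
Definition d_op (k : nat) := @divergence R ('rV[R]_3 -> R[i]^o) partial k.

Definition t_symb (xi : 'rV[R]_3) (k : nat) := @twistor R R[i]^o (xi_mul xi) k.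
Definition G_symb (xi : 'rV[R]_3) (k : nat) := @calG R R[i]^o (xi_mul xi) k.
Definition d_symb (xi : 'rV[R]_3) (k : nat) :=
  @divergence R R[i]^o (xi_mul xi) k.

End Fields.

Arguments Sfibre : clear implicits.
Arguments Ssections : clear implicits.

(* Main.v *)
Require Import Defs.
From HB Require Import structures.
From mathcomp Require Import all_boot all_order all_algebra all_fingroup.
From mathcomp Require Import complex.
From mathcomp Require Import all_classical all_reals all_analysis.
From mathcomp Require Import ring zify.

Set Implicit Arguments.
Unset Strict Implicit.
Unset Printing Implicit Defensive.

Import Order.TTheory GRing.Theory Num.Theory.
Import numFieldNormedType.Exports.

Local Open Scope classical_set_scope.
Local Open Scope ring_scope.
Local Open Scope complex_scope.

(* With [xi_A^B] viewed as a traceless matrix [M], one has [M ^ 2 = r ^ 2] with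
   [r ^ 2 = |xi|^2 / 2], and the Laplacian has symbol [- 2 r ^ 2]. Hence the symbol of
   [G_k] is the odd part in [r] of the binomial expansion of [(M + r)^{(x) k}]:
   with [N = M + r] and [N' = M - r],
     [2 r G_k = N^{(x) k} - N'^{(x) k}]   on symmetric spinors.
   Both [N (x) N] and [N' (x) N'] annihilate [xi_{AB}] on either side, which gives
   [G t = 0] and [d G = 0]. For exactness, expand [(2 r)^{(x) k} = (N - N')^{(x) k}]:
   the mixed terms factor through [t] and [d], so that
     [(2 r)^k phi = N^{(x) k} phi + (- N')^{(x) k} phi + t eta],
   where [eta] depends only on [d phi]. As [N N' = N' N = 0], this puts [ker G_k] in the
   image of [t], and gives [(2 r G_k)^2 = (2 r)^{2k}] on [ker d].
   The differential identities follow from those of the symbols, since polynomials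
   vanishing at all real [xi] are zero and smooth functions form a module over the
   polynomials in the commuting partial derivatives. *)

Lemma iter_closed (V : Type) (S : V -> Prop) (T : V -> V) n f :
  (forall g, S g -> S (T g)) -> S f -> S (iter n T f).
Proof. by move=> ST Sf; elim: n => //= n IH; apply: ST. Qed.

(** * Permutations of index tuples *)

Section Permutations.
Variables (V : Type) (k : nat).
Implicit Types (phi : spinor V k) (A B : k.-tuple 'I_2).

Lemma permute_tupleM (T : Type) (s t : 'S_k) (A : k.-tuple T) :
  permute_tuple s (permute_tuple t A) = permute_tuple (s * t)%g A.
Proof. by apply: eq_from_tnth => i; rewrite !tnth_mktuple permM. Qed.

Lemma permute_tuple1 (T : Type) (A : k.-tuple T) : permute_tuple 1%g A = A.
Proof. by apply: eq_from_tnth => i; rewrite tnth_mktuple perm1. Qed.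

Lemma perm_eq_permute_tuple (T : eqType) (A B : k.-tuple T) :
  perm_eq A B -> exists s : 'S_k, A = permute_tuple s B.
Proof. by case/tuple_permP => s eAB; exists s; apply: val_inj. Qed.

Lemma permute_tuple_perm_eq (T : eqType) (s : 'S_k) (A : k.-tuple T) :
  perm_eq (permute_tuple s A) A.
Proof. by apply/tuple_permP; exists s. Qed.

Lemma symmetric_perm_eq phi A B :
  symmetric_spinor phi -> perm_eq A B -> phi A = phi B.
Proof. by move=> sphi /perm_eq_permute_tuple[s ->]. Qed.

End Permutations.

(** * Symmetrization, and symmetry of the values of the operators *)

Section Operators.
Variables (R : realType) (V : lmodType R[i]) (pd : 'I_3 -> V -> V).

Lemma symmetrize_sym k (phi : spinor V k) : symmetric_spinor (symmetrize phi).
Proof.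
move=> t A; rewrite !ffunE; congr (_ *: _).
rewrite [RHS](reindex_inj (mulIg t)) /=.
by apply: eq_bigr => s _; rewrite permute_tupleM.
Qed.

Lemma symmetrize_id k (phi : spinor V k) :
  symmetric_spinor phi -> symmetrize phi = phi.
Proof.
move=> sphi; apply/ffunP => A; rewrite !ffunE.
rewrite (eq_bigr (fun=> phi A)); last by move=> s _; rewrite sphi.
rewrite sumr_const card_Sn -[X in _ *: X]scaler_nat scalerA mulVf ?scale1r//.
Qed.

Lemma symmetrize_permute k (phi : spinor V k) (t : 'S_k) :
  symmetrize [ffun A => phi (permute_tuple t A)] = symmetrize phi.
Proof.
apply/ffunP => A; rewrite !ffunE; congr (_ *: _).
rewrite [RHS](reindex_inj (mulgI t)) /=.
by apply: eq_bigr => s _; rewrite ffunE permute_tupleM.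
Qed.

Lemma symmetrizeD k (phi psi : spinor V k) :
  symmetrize (phi + psi) = symmetrize phi + symmetrize psi.
Proof.
apply/ffunP => A; rewrite !ffunE -scalerDr -big_split /=; congr (_ *: _).
by apply: eq_bigr => s _; rewrite ffunE.
Qed.

Lemma symmetrizeZ k c (phi : spinor V k) :
  symmetrize (c *: phi) = c *: symmetrize phi.
Proof.
apply/ffunP => A; rewrite !ffunE scalerA mulrC -scalerA; congr (_ *: _).
by rewrite scaler_sumr; apply: eq_bigr => s _; rewrite ffunE.
Qed.

Lemma symmetrize0 k : symmetrize (0 : spinor V k) = 0.
Proof. by rewrite -[X in symmetrize X](scale0r 0) symmetrizeZ scale0r. Qed.

Lemma symmetrize_sum k (I : finType) (P : pred I) (F : I -> spinor V k) :
  symmetrize (\sum_(i | P i) F i) = \sum_(i | P i) symmetrize (F i).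
Proof. by apply: (big_morph _ (@symmetrizeD k) (symmetrize0 k)). Qed.

Lemma symmetricD k (phi psi : spinor V k) :
  symmetric_spinor phi -> symmetric_spinor psi -> symmetric_spinor (phi + psi).
Proof. by move=> sphi spsi s A; rewrite !ffunE sphi spsi. Qed.

Lemma symmetricZ k c (phi : spinor V k) :
  symmetric_spinor phi -> symmetric_spinor (c *: phi).
Proof. by move=> sphi s A; rewrite !ffunE sphi. Qed.

Lemma symmetric_sum k n (F : 'I_n -> spinor V k) :
  (forall i, symmetric_spinor (F i)) -> symmetric_spinor (\sum_(i < n) F i).
Proof.
move=> sF; elim/big_ind: _ => //; last exact: symmetricD.
by move=> s A; rewrite !ffunE.
Qed.

Lemma twistor_sym k (phi : spinor V k) : symmetric_spinor (twistor pd phi).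
Proof. exact: symmetrize_sym. Qed.

Lemma calG_sym k (phi : spinor V k) : symmetric_spinor (calG pd phi).
Proof. by apply: symmetric_sum => n; apply/symmetricZ/symmetrize_sym. Qed.

Lemma divergence_sym k (phi : spinor V k.+2) :
  symmetric_spinor phi -> symmetric_spinor (divergence pd phi).
Proof.
move=> sphi s A; rewrite !ffunE; apply: eq_bigr => P _; apply: eq_bigr => Q _.
congr (Dup _ _ _ _); apply: symmetric_perm_eq => //=.
by rewrite -!cats1 !perm_cat2r permute_tuple_perm_eq.
Qed.

(** * Subspaces stable under the [pd i], such as the smooth functions *)

Section Closure.
Variable S : V -> Prop.
Hypotheses (S0 : S 0) (SD : forall f g, S f -> S g -> S (f + g))
  (SZ : forall c f, S f -> S (c *: f)) (Spd : forall i f, S f -> S (pd i f)).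

Lemma closed_sum (I : finType) (P : pred I) (F : I -> V) :
  (forall i, S (F i)) -> S (\sum_(i | P i) F i).
Proof. by move=> SF; elim/big_ind: _. Qed.

Lemma Ddown_closed A B f : S f -> S (Ddown pd A B f).
Proof.
move=> Sf; apply: SZ; case: ifP => _; first exact: Spd.
have SB g h : S g -> S h -> S (g - h).
  by move=> Sg Sh; rewrite -scaleN1r; apply: SD => //; apply: SZ.
have SipdD := SZ 'i%C (Spd 1 Sf); case: ifP => _; last exact: SD (Spd 0 Sf) SipdD.
by rewrite -scaleN1r; apply: SZ; exact: SB (Spd 0 Sf) SipdD.
Qed.

Lemma Dup_closed A B f : S f -> S (Dup pd A B f).
Proof.
by move=> Sf; do 2 apply: closed_sum => ?; apply: SZ; apply: Ddown_closed.
Qed.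

Lemma Dmix_closed A B f : S f -> S (Dmix pd A B f).
Proof. by move=> Sf; apply: closed_sum => ?; apply: SZ; apply: Ddown_closed. Qed.

Lemma Lap_closed f : S f -> S (Lap pd f).
Proof.
by move=> Sf; do 2 apply: closed_sum => ?; apply: Ddown_closed; apply: Dup_closed.
Qed.

Lemma symmetrize_closed k (phi : spinor V k) :
  (forall A, S (phi A)) -> forall A, S (symmetrize phi A).
Proof. by move=> Sphi A; rewrite ffunE; apply/SZ/closed_sum. Qed.

Lemma twistor_closed k (phi : spinor V k) :
  (forall A, S (phi A)) -> forall A, S (twistor pd phi A).
Proof.
by move=> Sphi; apply: symmetrize_closed => A; rewrite ffunE; apply: Ddown_closed.
Qed.

Lemma divergence_closed k (phi : spinor V k.+2) :
  (forall A, S (phi A)) -> forall A, S (divergence pd phi A).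
Proof.
by move=> Sphi A; rewrite ffunE; do 2 apply: closed_sum => ?; apply: Dup_closed.
Qed.

Lemma Gterm_closed k n (phi : spinor V k) :
  (forall A, S (phi A)) -> forall A, S (Gterm pd n phi A).
Proof.
move=> Sphi A; rewrite ffunE; apply: closed_sum => B.
rewrite /Dmix_iter; elim: (zip _ _) => [|ab l IH] /=; last exact: Dmix_closed.
by apply: iter_closed => [f|]; [exact: Lap_closed | exact: Sphi].
Qed.

Lemma calG_closed k (phi : spinor V k) :
  (forall A, S (phi A)) -> forall A, S (calG pd phi A).
Proof.
move=> Sphi A; rewrite sum_ffunE; apply: closed_sum => n; rewrite ffunE.
by apply: SZ; apply: symmetrize_closed; apply: Gterm_closed.
Qed.

End Closure.
End Operators.

(** * Naturality of the operators in linear maps intertwining the [pd i] *)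

Section Naturality.
Variables (R : realType) (V V' : lmodType R[i]).
Variables (pd : 'I_3 -> V -> V) (pd' : 'I_3 -> V' -> V').
Variable j : {linear V -> V'}.
Hypothesis j_pd : forall i f, j (pd i f) = pd' i (j f).

Definition map_spinor k (phi : spinor V k) : spinor V' k := [ffun A => j (phi A)].

Lemma Ddown_natural A B f : j (Ddown pd A B f) = Ddown pd' A B (j f).
Proof.
rewrite /Ddown linearZ /=; congr (_ *: _); case: ifP => _; first exact: j_pd.
by case: ifP => _; rewrite ?linearN linearD ?linearN linearZ /= !j_pd.
Qed.

Lemma Dup_natural A B f : j (Dup pd A B f) = Dup pd' A B (j f).
Proof.
rewrite /Dup linear_sum; apply: eq_bigr => C _; rewrite linear_sum.
by apply: eq_bigr => E _; rewrite linearZ Ddown_natural.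
Qed.

Lemma Dmix_natural A B f : j (Dmix pd A B f) = Dmix pd' A B (j f).
Proof.
by rewrite linear_sum; apply: eq_bigr => C _; rewrite linearZ Ddown_natural.
Qed.

Lemma Lap_natural f : j (Lap pd f) = Lap pd' (j f).
Proof.
rewrite linear_sum; apply: eq_bigr => A _; rewrite linear_sum.
by apply: eq_bigr => B _; rewrite Ddown_natural Dup_natural.
Qed.

Lemma symmetrize_natural k (phi : spinor V k) :
  map_spinor (symmetrize phi) = symmetrize (map_spinor phi).
Proof.
apply/ffunP => A; rewrite !ffunE linearZ linear_sum; congr (_ *: _).
by apply: eq_bigr => s _; rewrite ffunE.
Qed.

Lemma twistor_natural k (phi : spinor V k) :
  map_spinor (twistor pd phi) = twistor pd' (map_spinor phi).
Proof.
rewrite /twistor symmetrize_natural; congr symmetrize.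
by apply/ffunP => A; rewrite !ffunE Ddown_natural.
Qed.

Lemma divergence_natural k (phi : spinor V k.+2) :
  map_spinor (divergence pd phi) = divergence pd' (map_spinor phi).
Proof.
apply/ffunP => A; rewrite !ffunE linear_sum; apply: eq_bigr => P _.
by rewrite linear_sum; apply: eq_bigr => Q _; rewrite Dup_natural ffunE.
Qed.

Lemma Gterm_natural k n (phi : spinor V k) :
  map_spinor (Gterm pd n phi) = Gterm pd' n (map_spinor phi).
Proof.
apply/ffunP => A; rewrite !ffunE linear_sum; apply: eq_bigr => B _.
rewrite /Dmix_iter; elim: (zip _ _) => [|ab l IH] /=.
  by rewrite ffunE; elim: (n) (phi _) => //= i IH f; rewrite Lap_natural IH.
by rewrite Dmix_natural IH.
Qed.

Lemma calG_natural k (phi : spinor V k) :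
  map_spinor (calG pd phi) = calG pd' (map_spinor phi).
Proof.
apply/ffunP => A; rewrite !ffunE !sum_ffunE linear_sum; apply: eq_bigr => n _.
by rewrite -Gterm_natural -symmetrize_natural !ffunE linearZ.
Qed.

End Naturality.

(** * Tensor products of matrices acting on spinors *)

Section Tensors.
Variable R : realType.
Local Notation C := R[i].
Local Notation spin := (spinor C^o).

Lemma regZE (a : C) (b : C^o) : a *: b = a * b. Proof. by []. Qed.

Lemma big_tuple_cons (V : nmodType) (T : finType) k (F : k.+1.-tuple T -> V) :
  \sum_B F B = \sum_b \sum_(B : k.-tuple T) F [tuple of b :: B].
Proof.
rewrite pair_big /= (reindex (fun p : T * k.-tuple T => [tuple of p.1 :: p.2])) //=.
exists (fun B : k.+1.-tuple T => (thead B, [tuple of behead B])) => [[b B] _|B _] /=.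
  by congr pair; apply: val_inj.
by rewrite [RHS]tuple_eta.
Qed.

Lemma big_tuple0 (V : nmodType) (T : finType) (F : 0.-tuple T -> V) :
  \sum_B F B = F [tuple].
Proof. by rewrite (big_pred1 [tuple]) // => B; rewrite (tuple0 B). Qed.

(** The operator [X_0 (x) ... (x) X_{k-1}] on the [k]-th tensor power of [C^2], in components. *)
Definition tens k (X : 'I_k -> 'M[C]_2) (phi : spin k) : spin k :=
  [ffun A => \sum_B (\prod_i X i (tnth A i) (tnth B i)) * phi B].

Lemma eq_tens k (X Y : 'I_k -> 'M[C]_2) phi : X =1 Y -> tens X phi = tens Y phi.
Proof.
move=> eXY; apply/ffunP => A; rewrite !ffunE; apply: eq_bigr => B _.
by congr (_ * _); apply: eq_bigr => i _; rewrite eXY.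
Qed.

(** For symmetric [phi] the summed indices can be permuted along with the free ones, so that only
    the order of the factors changes. *)
Lemma tens_permute k (X : 'I_k -> 'M[C]_2) (phi : spin k) (s : 'S_k) A :
  symmetric_spinor phi ->
  tens X phi (permute_tuple s A) = tens (fun i => X (s^-1 i)%g) phi A.
Proof.
move=> sphi; rewrite !ffunE.
rewrite (reindex (permute_tuple s)) /=; last first.
  by exists (permute_tuple s^-1) => B _; rewrite permute_tupleM ?mulVg ?mulgV permute_tuple1.
apply: eq_bigr => B _; rewrite sphi; congr (_ * _).
rewrite [RHS](reindex_inj (@perm_inj _ s)) /=.
by apply: eq_bigr => i _; rewrite !tnth_mktuple permK.
Qed.

(** A permutation of the factors amounts to one of the free indices, which symmetrization
    absorbs. *)
Lemma symmetrize_tens_permute k (X : 'I_k -> 'M[C]_2) (phi : spin k) (s : 'S_k) :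
  symmetric_spinor phi ->
  symmetrize (tens (fun i => X (s i)) phi) = symmetrize (tens X phi).
Proof.
move=> sphi; rewrite -[RHS](symmetrize_permute _ s^-1); congr symmetrize.
apply/ffunP => A; rewrite [RHS]ffunE tens_permute //.
by rewrite invgK.
Qed.

Lemma tens_sym k (X : 'M[C]_2) (phi : spin k) :
  symmetric_spinor phi -> symmetric_spinor (tens (fun=> X) phi).
Proof. by move=> sphi s A; rewrite tens_permute. Qed.

Lemma tensM k (X Y : 'I_k -> 'M[C]_2) (phi : spin k) :
  tens X (tens Y phi) = tens (fun i => X i *m Y i) phi.
Proof.
apply/ffunP => A; rewrite !ffunE.
under eq_bigr => B _ do rewrite ffunE mulr_sumr.
rewrite exchange_big /=; apply: eq_bigr => B _.
under eq_bigr => D _ do rewrite mulrA -big_split /=.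
rewrite -mulr_suml; congr (_ * _).
under [RHS]eq_bigr => i _ do rewrite mxE.
rewrite bigA_distr_bigA /=.
rewrite (reindex (fun f : {ffun 'I_k -> 'I_2} => [tuple f i | i < k])) /=.
  by apply: eq_bigr => f _; apply: eq_bigr => i _; rewrite tnth_mktuple.
exists (fun D : k.-tuple 'I_2 => [ffun i => tnth D i]) => [f _|D _].
  by apply/ffunP => i; rewrite ffunE tnth_mktuple.
by apply: eq_from_tnth => i; rewrite tnth_mktuple ffunE.
Qed.

Lemma tensD k (X : 'I_k -> 'M[C]_2) (phi psi : spin k) :
  tens X (phi + psi) = tens X phi + tens X psi.
Proof.
apply/ffunP => A; rewrite !ffunE -big_split /=; apply: eq_bigr => B _.
by rewrite ffunE mulrDr.
Qed.

Lemma tensZ k (X : 'I_k -> 'M[C]_2) c (phi : spin k) :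
  tens X (c *: phi) = c *: tens X phi.
Proof.
apply/ffunP => A; rewrite !ffunE scaler_sumr; apply: eq_bigr => B _.
by rewrite ffunE !regZE mulrCA.
Qed.

Lemma tensB k (X : 'I_k -> 'M[C]_2) (phi psi : spin k) :
  tens X (phi - psi) = tens X phi - tens X psi.
Proof. by rewrite -scaleN1r tensD tensZ scaleN1r. Qed.

Lemma tens_scale k (c : 'I_k -> C) (X : 'I_k -> 'M[C]_2) (phi : spin k) :
  tens (fun i => c i *: X i) phi = (\prod_i c i) *: tens X phi.
Proof.
apply/ffunP => A; rewrite !ffunE scaler_sumr; apply: eq_bigr => B _.
rewrite !regZE mulrA -big_split; congr (_ * _); apply: eq_bigr => i _.
by rewrite mxE.
Qed.

Lemma tens1 k (phi : spin k) : tens (fun=> 1%:M) phi = phi.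
Proof.
apply/ffunP => A; rewrite ffunE (bigD1 A) //= big1 ?mul1r; last first.
  by move=> i _; rewrite mxE eqxx.
rewrite big1 ?addr0 // => B neAB.
have [i neABi] : exists i, tnth A i != tnth B i.
  apply/existsP; apply: contraNT neAB; rewrite negb_exists => /forallP eAB.
  by apply/eqP/eq_from_tnth => i; apply/esym/eqP; rewrite -[_ == _]negbK eAB.
by rewrite (bigD1 i) //= mxE (negPf neABi) !mul0r.
Qed.

Lemma tens_eq0 k (X : 'I_k -> 'M[C]_2) i (phi : spin k) : X i = 0 -> tens X phi = 0.
Proof.
move=> Xi0; apply/ffunP => A; rewrite !ffunE big1 // => B _.
by rewrite (bigD1 i) //= Xi0 mxE !mul0r.
Qed.

Lemma tens_expand k (X Y : 'I_k -> 'M[C]_2) (phi : spin k) :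
  tens (fun i => X i + Y i) phi =
  \sum_(J : {set 'I_k}) tens (fun i => if i \in J then X i else Y i) phi.
Proof.
apply/ffunP => A; rewrite sum_ffunE ffunE.
under [RHS]eq_bigr => J _ do rewrite ffunE.
rewrite exchange_big /=; apply: eq_bigr => B _.
under eq_bigr => i _ do rewrite mxE.
rewrite bigA_distr mulr_suml; apply: eq_bigr => J _; congr (_ * _).
by apply: eq_bigr => i _; case: ifP.
Qed.

Lemma tens_cons k (X : 'I_k.+1 -> 'M[C]_2) (phi : spin k.+1) a (A : k.-tuple 'I_2) :
  tens X phi [tuple of a :: A] = \sum_b X ord0 a b *
    tens (fun i => X (lift ord0 i)) [ffun B : k.-tuple 'I_2 => phi [tuple of b :: B]] A.
Proof.
rewrite ffunE big_tuple_cons; apply: eq_bigr => b _; rewrite ffunE mulr_sumr.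
apply: eq_bigr => B _; rewrite big_ord_recl !tnth0 -mulrA ffunE; congr (_ * (_ * _)).
by apply: eq_bigr => i _; rewrite !tnthS.
Qed.

Lemma symmetrize_tens k (X : 'M[C]_2) (phi : spin k) :
  symmetrize (tens (fun=> X) phi) = tens (fun=> X) (symmetrize phi).
Proof.
apply/ffunP => A; rewrite !ffunE.
under [RHS]eq_bigr => B _ do rewrite ffunE regZE mulrCA.
rewrite -mulr_sumr regZE; congr (_ * _).
under [RHS]eq_bigr => B _ do rewrite mulr_sumr.
rewrite [RHS]exchange_big /=; apply: eq_bigr => s _; rewrite ffunE.
rewrite (reindex (permute_tuple s)) /=; last first.
  by exists (permute_tuple s^-1) => B _; rewrite permute_tupleM ?mulVg ?mulgV permute_tuple1.
apply: eq_bigr => B _; congr (_ * _).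
rewrite [RHS](reindex_inj (@perm_inj _ s)) /=.
by apply: eq_bigr => i _; rewrite !tnth_mktuple.
Qed.

(** The indicator tuples of two sets of equal size contain equally many [true] and equally many
    [false], hence are permutations of each other. *)
Lemma set_perm_transitive k (J J' : {set 'I_k}) : #|J| = #|J'| ->
  exists s : 'S_k, forall i, (s i \in J') = (i \in J).
Proof.
move=> eJJ'; pose t (J : {set 'I_k}) := [tuple i \in J | i < k].
have cnt b L : count_mem b (t L) = if b then #|L| else (k - #|L|)%N.
  have eT : count_mem true (t L) = #|L|.
    rewrite -sum1_count big_tuple -sum1_card; apply: eq_bigl => i.
    by rewrite tnth_mktuple /= eqb_id.
  case: b => //; have := count_predC (pred1 true) (t L).
  rewrite size_tuple eT => /(congr1 (subn^~ #|L|)); rewrite addKn => <-.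
  by apply: eq_count => -[].
have /perm_eq_permute_tuple[s es] : perm_eq (t J) (t J').
  by apply/allP => b _; rewrite /= !cnt eJJ'.
exists s => i.
by have := congr1 (fun u => tnth u i) es; rewrite !tnth_mktuple => ->.
Qed.

Lemma symmetrize_tens_card k (X Y : 'M[C]_2) (J J' : {set 'I_k}) (phi : spin k) :
  symmetric_spinor phi -> #|J| = #|J'| ->
  symmetrize (tens (fun i => if i \in J then X else Y) phi) =
  symmetrize (tens (fun i => if i \in J' then X else Y) phi).
Proof.
move=> sphi /set_perm_transitive[s eJ].
rewrite -[RHS](symmetrize_tens_permute (fun i => if i \in J' then X else Y) s sphi).
by congr symmetrize; apply: eq_tens => i; rewrite eJ.
Qed.

Lemma card_final_segment k j : (j <= k)%N -> #|[set i : 'I_k | (k - j <= i)%N]%SET| = j.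
Proof.
move=> lejk; rewrite cardsE -sum1_card big_mkcond /=.
rewrite -(big_mkord xpredT (fun i => if (k - j <= i)%N then 1%N else 0%N)).
rewrite (big_cat_nat (n := (k - j)%N)) ?leq_subr //= big_nat big1 ?add0n; last first.
  by move=> i /andP[_ lti]; rewrite leqNgt lti.
rewrite big_nat (eq_bigr (fun=> 1%N)); last by move=> i /andP[-> _].
by rewrite -big_nat sum_nat_const_nat muln1 subKn.
Qed.

(** A standard representative of the terms with [j] identity factors. The identities come last, as
    in [Gterm], where the derivatives sit on the first [k - 2n - 1] indices. *)
Definition tens_head k (X : 'M[C]_2) j (phi : spin k) : spin k :=
  tens (fun i : 'I_k => if (k - j <= i)%N then 1%:M else X) phi.

(** Expanding over the set [J] of positions that receive the scalar, symmetrization leaves a term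
    depending only on [#|J|], and there are ['C(k, j)] sets of size [j]. *)
Lemma tens_binomial k (X : 'M[C]_2) (c : C) (phi : spin k) : symmetric_spinor phi ->
  tens (fun=> c%:M + X) phi =
  \sum_(j < k.+1) ('C(k, j)%:R * c ^+ j) *: symmetrize (tens_head X j phi).
Proof.
move=> sphi; rewrite -[LHS]symmetrize_id; last exact: tens_sym.
rewrite tens_expand symmetrize_sum.
(* A subset of ['I_k] has at most [k] elements, so [inord] never falls back on its default value. *)
rewrite (partition_big (fun J : {set 'I_k} => inord #|J| : 'I_k.+1) xpredT) //=.
apply: eq_bigr => j _.
rewrite (eq_bigr (fun=> c ^+ j *: symmetrize (tens_head X j phi))).
  rewrite sumr_const -[LHS]scaler_nat scalerA; congr (_%:R * _ *: _).
  rewrite -[k in 'C(k, _)]card_ord -card_draws; apply: eq_card => J.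
  rewrite !inE -[LHS]/(nat_of_ord (inord #|J| : 'I_k.+1) == j) inordK // ltnS -[k in (_ <= k)%N]card_ord.
  exact: max_card.
move=> J /eqP eJ; have {}eJ : #|J| = j.
  by rewrite -eJ inordK // ltnS -[k in (_ <= k)%N]card_ord max_card.
have -> : tens (fun i => if i \in J then c%:M else X) phi =
    c ^+ j *: tens (fun i => if i \in J then 1%:M else X) phi.
  have -> : c ^+ j = \prod_i (if i \in J then c else 1).
    by rewrite -big_mkcond prodr_const eJ.
  rewrite -tens_scale; apply: eq_tens => i; case: ifP => _; last by rewrite scale1r.
  by rewrite scalemx1.
apply: etrans (symmetrizeZ _ _) _; congr (_ *: _).
have eJs : #|J| = #|[set i : 'I_k | (k - j <= i)%N]%SET|.
  by rewrite card_final_segment // -ltnS.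
apply: etrans (symmetrize_tens_card 1%:M X sphi eJs) _.
by congr symmetrize; apply: eq_tens => i; rewrite inE.
Qed.

End Tensors.

(** * Sums over two values and over initial segments *)

Lemma sum_I2 (V : nmodType) (F : 'I_2 -> V) : \sum_i F i = F 0 + F 1.
Proof. by rewrite !big_ord_recl big_ord0 addr0; congr (_ + F _); apply: val_inj. Qed.

Lemma forall_I2 (P : 'I_2 -> Prop) : P 0 -> P 1 -> forall A, P A.
Proof.
by move=> P0 P1 [[|[|//]] i]; [move: P0 | move: P1]; congr P; apply: val_inj.
Qed.

Lemma sum_ord_widen (V : nmodType) m n (F : nat -> V) : (m <= n)%N ->
  (forall i, (m <= i)%N -> F i = 0) -> \sum_(i < m) F i = \sum_(i < n) F i.
Proof.
move=> lemn F0; rewrite -!(big_mkord xpredT) (@big_cat_nat _ _ _ m 0 n) //=.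
by rewrite [X in _ + X]big_nat [X in _ + X]big1 ?addr0 // => i /andP[/F0].
Qed.

Lemma sum_ord_double (V : nmodType) n (F : nat -> V) :
  \sum_(i < n.*2) F i = \sum_(i < n) (F i.*2 + F i.*2.+1).
Proof. by elim: n => [|n IH]; rewrite ?big_ord0 // doubleS !big_ord_recr /= IH addrA. Qed.

(** * The symbols of the operators in matrix form *)

Section Symbols.
Variables (R : realType) (xi : 'rV[R]_3).
Local Notation C := R[i].
Local Notation spin := (spinor C^o).
Local Notation pd := (xi_mul xi).

(** On [C^o] each [pd i] is a multiplication, so every scalar operator is multiplication by its
    value at [1]. *)
Definition xi_down (A B : 'I_2) : C := Ddown (V := C^o) pd A B 1.
Definition xi_mix : 'M[C]_2 := \matrix_(A, B) Dmix (V := C^o) pd A B 1.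
(** Minus the determinant of [xi_mix]; it equals [|xi|^2 / 2]. *)
Definition xi_sq : C := xi_down 0 1 ^+ 2 - xi_down 0 0 * xi_down 1 1.

Lemma Ddown_symb A B (f : C^o) : Ddown pd A B f = xi_down A B * f.
Proof.
rewrite /xi_down /Ddown !regZE -mulrA; congr (_ * _).
by case: ifP => _; [|case: ifP => _]; rewrite /xi_mul ?regZE mulr1 //; ring.
Qed.

Lemma xi_downC A B : xi_down A B = xi_down B A.
Proof.
have [->//|neAB] := eqVneq A B.
by rewrite /xi_down /Ddown neAB eq_sym neAB.
Qed.

Lemma Dmix_symb A B (f : C^o) : Dmix pd A B f = xi_mix A B * f.
Proof.
rewrite mxE mulr_suml; apply: eq_bigr => D _.
by rewrite [in LHS]Ddown_symb regZE [Ddown _ _ _ 1]Ddown_symb mulr1 mulrA.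
Qed.

Lemma epsE : (eps C 0 0 = 0) * (eps C 0 1 = 1) * (eps C 1 0 = -1) * (eps C 1 1 = 0).
Proof. by rewrite /eps !ltnn /= subrr subr0 sub0r. Qed.

Definition xi_up (A B : 'I_2) : C := Dup (V := C^o) pd A B 1.

Lemma Dup_symb A B (f : C^o) : Dup pd A B f = xi_up A B * f.
Proof.
rewrite /xi_up /Dup mulr_suml; apply: eq_bigr => D _; rewrite mulr_suml.
by apply: eq_bigr => E _; rewrite [in LHS]Ddown_symb regZE mulrA.
Qed.

Lemma xi_upE : (xi_up 0 0 = xi_down 1 1) * (xi_up 0 1 = - xi_down 0 1) *
  (xi_up 1 0 = - xi_down 0 1) * (xi_up 1 1 = xi_down 0 0).
Proof.
have E A B : xi_up A B =
    \sum_D \sum_E eps C A D * eps C B E * xi_down D E.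
  by apply: eq_bigr => D _; apply: eq_bigr => F _; rewrite Ddown_symb mulr1.
have := xi_downC 1 0; have := epsE; move: E.
move: (eps C) xi_up xi_down => e u d E eE dC.
by do !split; rewrite E !sum_I2 !eE ?dC; ring.
Qed.

Lemma xi_mixE : (xi_mix 0 0 = xi_down 0 1) * (xi_mix 0 1 = - xi_down 0 0) *
  (xi_mix 1 0 = xi_down 1 1) * (xi_mix 1 1 = - xi_down 0 1).
Proof.
have E A B : xi_mix A B = \sum_D eps C B D * xi_down A D.
  by rewrite mxE; apply: eq_bigr => D _; rewrite Ddown_symb mulr1.
have := xi_downC 1 0; have := epsE; move: E.
move: (eps C) (xi_mix : 'I_2 -> 'I_2 -> C) xi_down => e u d E eE dC.
by do !split; rewrite E !sum_I2 !eE ?dC; ring.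
Qed.

Lemma Lap_symb (f : C^o) : Lap pd f = - 2 * xi_sq * f.
Proof.
have -> : Lap pd f = \sum_A \sum_B xi_down A B * (xi_up A B * f).
  by apply: eq_bigr => A _; apply: eq_bigr => B _; rewrite Ddown_symb Dup_symb.
rewrite /xi_sq; have := xi_downC 1 0; have := xi_upE.
move: xi_up xi_down => u d uE dC.
by rewrite !sum_I2 !uE dC; ring.
Qed.

Lemma iter_Lap_symb n (f : C^o) : iter n (Lap pd) f = (- 2 * xi_sq) ^+ n * f.
Proof.
by elim: n => [|n IH]; rewrite ?mul1r //= IH Lap_symb exprS -!mulrA.
Qed.

(** Induction on [m]: each of the first [m] factors is one application of [Dmix], and the identity
    factors collapse the remaining sums to the indices of [A]. The values [F] are taken on sequences
    so that concatenated indices need no cast. *)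
Lemma Dmix_iter_symb m k (A : k.-tuple 'I_2) (F : seq 'I_2 -> C) : (m <= k)%N ->
  \sum_(B : k.-tuple 'I_2)
    (\prod_(i < k) (if (m <= i)%N then 1%:M else xi_mix) (tnth A i) (tnth B i)) * F B =
  \sum_(B : m.-tuple 'I_2) Dmix_iter (V := C^o) pd (take m A) B (F (B ++ drop m A)).
Proof.
elim: m k A F => [|m IH] k A F lemk.
  rewrite big_tuple0 /Dmix_iter take0 drop0 /=.
  have := tens1 ([ffun B : k.-tuple 'I_2 => F B] : spin k).
  move=> /(congr1 (fun g : spin k => g A)); rewrite !ffunE => <-.
  by apply: eq_bigr => B _; rewrite ffunE.
case: k A lemk => // k A lemk; rewrite !big_tuple_cons.
case/tupleP: A => a A; apply: eq_bigr => b _.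
rewrite /Dmix_iter /=.
under [RHS]eq_bigr => B _ do rewrite Dmix_symb.
rewrite -[RHS]mulr_sumr -(IH _ A (fun s => F (b :: s))) // mulr_sumr.
apply: eq_bigr => B _; rewrite big_ord_recl !tnth0 /= -mulrA; congr (_ * (_ * _)).
by apply: eq_bigr => i _; rewrite !tnthS /bump /= add1n ltnS.
Qed.

Lemma Gterm_symb k n (phi : spin k) : symmetric_spinor phi ->
  Gterm pd n phi = (- 2 * xi_sq) ^+ n *: tens_head xi_mix n.*2.+1 phi.
Proof.
move=> sphi; apply/ffunP => A; rewrite !ffunE regZE.
have lemk := leq_subr n.*2.+1 k; set m := (k - _)%N in lemk *.
(* The default tuple is immaterial: [F] is only evaluated on sequences of length [k]. *)
pose F (s : seq 'I_2) := phi (insubd [tuple of nseq k ord0] s).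
have Fphi (B : k.-tuple 'I_2) : phi B = F B by rewrite /F valKd.
under [X in _ = _ * X]eq_bigr => B _ do rewrite Fphi.
rewrite (Dmix_iter_symb A F lemk) mulr_sumr; apply: eq_bigr => B _.
rewrite iter_Lap_symb.
(* [Gterm] places the contracted indices last and [tens_head] places them first; the symmetry of
   [phi] makes up for this. *)
have -> (p : (m <= k)%N) : phi (tail_cat p A B) = F (B ++ drop m A).
  apply: symmetric_perm_eq => //.
  have sz : size (B ++ drop m A) == k.
    by rewrite size_cat size_drop !size_tuple subnKC.
  by rewrite val_insubd sz val_tcast perm_catC.
rewrite /Dmix_iter; elim: (zip _ _) => //= ab l IH.
by rewrite !Dmix_symb IH mulrCA.
Qed.

(** In the difference of the two binomial expansions the even powers of [r] cancel and the odd ones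
    double. The term of degree [2n + 1] carries [r * xi_sq ^ n], and the factor [(-2) ^- n] of
    [calG] cancels the power of [-2] in the symbol of the iterated Laplacian. *)
Lemma calG_symb k r (phi : spin k) : symmetric_spinor phi -> r ^+ 2 = xi_sq ->
  (2 * r) *: calG pd phi =
  tens (fun=> r%:M + xi_mix) phi - tens (fun=> (- r)%:M + xi_mix) phi.
Proof.
move=> sphi r2; rewrite !tens_binomial // -sumrB.
pose T j := symmetrize (tens_head xi_mix j phi).
pose F j : spin k := ('C(k, j)%:R * r ^+ j - 'C(k, j)%:R * (- r) ^+ j) *: T j.
rewrite (eq_bigr (fun j : 'I_k.+1 => F j)); last by move=> j _; rewrite -scalerBl.
have F0 j : (k < j)%N -> F j = 0.
  by move=> ltkj; rewrite /F bin_small // !mul0r subrr scale0r.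
(* Both sums are padded by terms with vanishing binomial coefficient: this one to [2 (k + 1)] terms,
   so that it splits by parity, and that of [calG] to [k + 1] terms. *)
rewrite (@sum_ord_widen _ _ k.+1.*2) //; last by rewrite -addnn leq_addr.
rewrite sum_ord_double /calG scaler_sumr.
pose H n : spin k := (2 * r * ('C(k, n.*2.+1)%:R * xi_sq ^+ n)) *: T n.*2.+1.
rewrite (eq_bigr (fun n : 'I__ => H n)); last first.
  move=> n _; rewrite Gterm_symb // symmetrizeZ !scalerA; congr (_ *: _).
  rewrite -!mulrA; do 3 congr (_ * _).
  by rewrite exprMn mulrA mulVf ?mul1r // expf_neq0 // oppr_eq0 pnatr_eq0.
rewrite (@sum_ord_widen _ _ k.+1); first last.
- move=> n len; rewrite /H bin_small ?mul0r ?mulr0 ?scale0r //.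
  by case: k len {sphi phi T F F0 H} => // k; rewrite -leq_double; lia.
- by rewrite ltnS; lia.
apply: eq_bigr => n _; have -> : F n.*2 = 0.
  by rewrite /F -mul2n exprM [(- r) ^+ _]exprM sqrrN subrr scale0r.
rewrite add0r; congr (_ *: _); rewrite -mul2n !exprS !exprM sqrrN r2.
by ring.
Qed.
End Symbols.

(** * Two-by-two matrix identities for [M], [N] and [N'] *)

Section Elliptic.
Variables (R : realType) (xi : 'rV[R]_3).
Local Notation C := R[i].
Local Notation spin := (spinor C^o).
Local Notation pd := (xi_mul xi).
Local Notation a := (xi_down xi 0 0).
Local Notation b := (xi_down xi 0 1).
Local Notation c := (xi_down xi 1 1).
Local Notation M := (xi_mix xi).

Lemma xi_sqE :
  xi_sq xi = ((xi 0 0 ^+ 2 + xi 0 1 ^+ 2 + xi 0 2 ^+ 2) / 2)%:C.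
Proof.
have s2 : ((Num.sqrt (2 : R))%:C)^-1 ^+ 2 = (2^-1)%:C :> C.
  by rewrite -fmorphV -rmorphXn /= exprVn sqr_sqrtr.
rewrite /xi_sq /xi_down /Ddown /= !regZE /xi_mul.
move: ((Num.sqrt (2 : R))%:C)^-1 s2 => s s2.
rewrite !mulr1 !rmorphM !rmorphD !rmorphXn /= -s2.
have i2 := sqr_i R.
move: 'i i2 => j j2.
have -> : (s * (xi 0 2)%:C) ^+ 2 - s * - ((xi 0 0)%:C - j * (xi 0 1)%:C) *
    (s * ((xi 0 0)%:C + j * (xi 0 1)%:C)) =
  s ^+ 2 * ((xi 0 0)%:C ^+ 2 - j ^+ 2 * (xi 0 1)%:C ^+ 2 + (xi 0 2)%:C ^+ 2) by ring.
by rewrite j2; ring.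
Qed.

(** For real nonzero [xi] the value [|xi|^2 / 2] is positive and has a nonzero real square root.
    Ellipticity rests on this. *)
Lemma xi_sq_root : xi != 0 -> exists2 r : C, r != 0 & r ^+ 2 = xi_sq xi.
Proof.
move=> xi0; set n2 := xi 0 0 ^+ 2 + xi 0 1 ^+ 2 + xi 0 2 ^+ 2.
have n2ge0 : 0 <= n2 by rewrite !addr_ge0 ?sqr_ge0.
have n2gt0 : 0 < n2.
  rewrite lt_neqAle n2ge0 andbT; apply: contra_neq xi0 => /esym/eqP.
  rewrite !paddr_eq0 ?addr_ge0 ?sqr_ge0 // !sqrf_eq0 => /andP[/andP[/eqP x0 /eqP x1] /eqP x2].
  apply/rowP => i; rewrite mxE; case: i => [[|[|[|//]]] lti].
  - by rewrite -[RHS]x0; congr (xi 0 _); apply: val_inj.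
  - by rewrite -[RHS]x1; congr (xi 0 _); apply: val_inj.
  - by rewrite -[RHS]x2; congr (xi 0 _); apply: val_inj.
exists (Num.sqrt (n2 / 2))%:C.
  by rewrite fmorph_eq0 sqrtr_eq0 -ltNge divr_gt0.
by rewrite xi_sqE -rmorphXn /= sqr_sqrtr // divr_ge0.
Qed.

Lemma shift_mixE (r : C) : ((r%:M + M) 0 0 = r + b) * ((r%:M + M) 0 1 = - a) *
  ((r%:M + M) 1 0 = c) * ((r%:M + M) 1 1 = r - b).
Proof.
have E A B : (r%:M + M) A B = r *+ (A == B) + M A B by rewrite [LHS]mxE [X in X + _]mxE.
by do !split; rewrite E xi_mixE /= ?mulr1n ?mulr0n ?add0r.
Qed.

Section Root.
Variable r : C.
Hypotheses (r2 : r ^+ 2 = xi_sq xi).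
Local Notation N := (r%:M + M).
Local Notation N' := ((- r)%:M + M).

(** As [N] commutes with [M], applying [N (x) N] to [xi_{BD}] multiplies it by
    [det N = r ^ 2 - xi_sq], which vanishes. Only [r ^ 2] is constrained, so the same holds for
    [- r], that is, for [N']. *)
Lemma shift_mix_down P Q : \sum_B \sum_D N P B * N Q D * xi_down xi B D = 0.
Proof.
have E : r ^+ 2 - (b ^+ 2 - a * c) = 0 by rewrite r2 subrr.
rewrite -[RHS](mul0r (xi_down xi P Q)) -[in RHS]E.
have := shift_mixE r; have := xi_downC xi 1 0.
move: (N : 'I_2 -> 'I_2 -> C) (xi_down xi) => n d dC nE.
by move: Q; apply: forall_I2; move: P; apply: forall_I2; rewrite !sum_I2 !nE ?dC; ring.
Qed.

(** The dual identity: contracting [xi^{PQ}] with [N (x) N] multiplies it by [det N = 0]. *)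
Lemma shift_mix_up B D : \sum_P \sum_Q xi_up xi P Q * (N P B * N Q D) = 0.
Proof.
have E : r ^+ 2 - (b ^+ 2 - a * c) = 0 by rewrite r2 subrr.
rewrite -[RHS](mul0r (xi_up xi B D)) -[in RHS]E.
have := shift_mixE r; have := xi_downC xi 1 0; have := xi_upE xi.
move: (N : 'I_2 -> 'I_2 -> C) (xi_down xi) (xi_up xi) => n d u uE dC nE.
by move: D; apply: forall_I2; move: B; apply: forall_I2; rewrite !sum_I2 !nE !uE; ring.
Qed.

(** The operator on the left is [2 (M (x) M - r ^ 2)]. On symmetric [x] it has rank one: it
    contracts with [xi^{BD}] and multiplies by [xi_{PQ}]. This is how mixed terms factor through the
    symbols of the divergence and the twistor operator. *)
Lemma shift_mix_anticomm (x : 'I_2 -> 'I_2 -> C) P Q : x 1 0 = x 0 1 ->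
  \sum_B \sum_D (N P B * N' Q D + N' P B * N Q D) * x B D =
  2 * xi_down xi P Q * \sum_B \sum_D xi_up xi B D * x B D.
Proof.
move=> xC; have E : b ^+ 2 - a * c - r ^+ 2 = 0 by rewrite r2 subrr.
(* As polynomials the two sides differ by [2 (xi_sq - r ^ 2) x_{PQ}], which is inserted here as a
   zero. *)
apply: etrans (addr0 _); rewrite -[X in _ = _ + X](mul0r (2 * x P Q)).
rewrite -[X in _ = _ + X * _]E.
have := shift_mixE r; have := shift_mixE (- r).
have := xi_downC xi 1 0; have := xi_upE xi.
move: (N : 'I_2 -> 'I_2 -> C) (N' : 'I_2 -> 'I_2 -> C) => n n'.
move: (xi_down xi) (xi_up xi) => d u uE dC n'E nE.
by move: Q; apply: forall_I2; move: P; apply: forall_I2;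
  rewrite !sum_I2 !nE !n'E !uE ?dC xC; ring.
Qed.

(** Cayley-Hamilton for the traceless matrix [M], whose determinant is [- xi_sq]. *)
Lemma mix_sq : M *m M = (r ^+ 2)%:M.
Proof.
rewrite r2 /xi_sq; apply/matrixP => P Q; rewrite mxE [RHS]mxE.
have := xi_mixE xi.
move: (M : 'I_2 -> 'I_2 -> C) (xi_down xi) => m d mE.
by move: Q; apply: forall_I2; move: P; apply: forall_I2;
  rewrite sum_I2 !mE /= ?mulr1n ?mulr0n; ring.
Qed.

Lemma shift_mixM (s t : C) :
  (s%:M + M) *m (t%:M + M) = (s * t + r ^+ 2)%:M + (s + t) *: M.
Proof.
rewrite mulmxDl !mulmxDr mix_sq !mul_scalar_mx mul_mx_scalar.
move: M => m; apply/matrixP => P Q; rewrite !mxE; move: (m P Q) => {}m.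
by case: (P == Q); rewrite ?mulr1n ?mulr0n; ring.
Qed.

Lemma shift_mixMN : N *m N' = 0.
Proof. by rewrite shift_mixM mulrN -expr2 addNr subrr scale0r addr0 raddf0. Qed.

Lemma shift_mixNM : N' *m N = 0.
Proof. by rewrite shift_mixM mulNr -expr2 addNr addNr scale0r addr0 raddf0. Qed.

(** Up to the factor [2 s] these matrices are projections; [s = r] gives [N] and [s = - r] gives
    [N']. *)
Lemma shift_mix_idem (s : C) : s ^+ 2 = r ^+ 2 ->
  (s%:M + M) *m (s%:M + M) = (2 * s) *: (s%:M + M).
Proof.
move=> s2; rewrite shift_mixM -s2 scalerDr scale_scalar_mx.
by congr (_%:M + _ *: _); ring.
Qed.

End Root.
End Elliptic.

(** * The first two indices split off: slices and outer products *)

Section EllipticComplex.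
Variables (R : realType) (xi : 'rV[R]_3).
Local Notation C := R[i].
Local Notation spin := (spinor C^o).
Local Notation pd := (xi_mul xi).
Local Notation M := (xi_mix xi).

Definition slice2 k (phi : spin k.+2) (B D : 'I_2) : spin k :=
  [ffun A : k.-tuple 'I_2 => phi [tuple of B :: [tuple of D :: A]]].

Definition outer2 k (d : 'I_2 -> 'I_2 -> C) (phi : spin k) : spin k.+2 :=
  [ffun A : k.+2.-tuple 'I_2 => d (thead A) (thead [tuple of behead A]) *
     phi [tuple of behead (behead A)]].

Lemma tens_cons2 k (X : 'I_k.+2 -> 'M[C]_2) (phi : spin k.+2) P Q (A : k.-tuple 'I_2) :
  tens X phi [tuple of P :: [tuple of Q :: A]] =
  \sum_B \sum_D X ord0 P B * X (lift ord0 ord0) Q D *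
    tens (fun i => X (lift ord0 (lift ord0 i))) (slice2 phi B D) A.
Proof.
rewrite tens_cons; apply: eq_bigr => B _; rewrite tens_cons mulr_sumr.
apply: eq_bigr => D _; rewrite mulrA; congr (_ * _); congr (tens _ _ A).
by apply/ffunP => A'; rewrite !ffunE.
Qed.

Lemma outer2_cons2 k d (phi : spin k) P Q (A : k.-tuple 'I_2) :
  outer2 d phi [tuple of P :: [tuple of Q :: A]] = d P Q * phi A.
Proof. by rewrite ffunE theadE; congr (d _ _ * phi _); apply: val_inj. Qed.

Lemma slice2_outer2 k d (phi : spin k) B D : slice2 (outer2 d phi) B D = d B D *: phi.
Proof. by apply/ffunP => A; rewrite ffunE outer2_cons2 ffunE. Qed.

Lemma twistor_outer2 k (phi : spin k) :
  twistor pd phi = symmetrize (outer2 (xi_down xi) phi).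
Proof.
by congr symmetrize; apply/ffunP => A; rewrite [LHS]ffunE [RHS]ffunE Ddown_symb.
Qed.

(** By symmetry the contraction can be moved from the last two indices to the first two, where
    [tens] is easily peeled. *)
Lemma divergence_slice2 k (phi : spin k.+2) : symmetric_spinor phi ->
  divergence pd phi = \sum_P \sum_Q xi_up xi P Q *: slice2 phi P Q.
Proof.
move=> sphi; apply/ffunP => A; rewrite ffunE sum_ffunE; apply: eq_bigr => P _.
rewrite sum_ffunE; apply: eq_bigr => Q _; rewrite Dup_symb !ffunE regZE.
congr (_ * _); apply: symmetric_perm_eq => //=.
by rewrite -!cats1 -catA perm_catC.
Qed.

Lemma tens_sum k (X : 'I_k -> 'M[C]_2) n (F : 'I_n -> spin k) :
  tens X (\sum_i F i) = \sum_i tens X (F i).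
Proof.
apply: (big_morph _ (tensD X)); apply/ffunP => A.
by rewrite !ffunE big1 // => B _; rewrite ffunE mulr0.
Qed.

Lemma tens_outer2_eq0 k (X : 'I_k.+2 -> 'M[C]_2) (phi : spin k) d :
  (forall P Q, \sum_B \sum_D X ord0 P B * X (lift ord0 ord0) Q D * d B D = 0) ->
  tens X (outer2 d phi) = 0.
Proof.
move=> X0; apply/ffunP => A; case/tupleP: A => P A; case/tupleP: A => Q A.
rewrite tens_cons2 ffunE.
under eq_bigr => B _ do under eq_bigr => D _ do
  rewrite slice2_outer2 tensZ ffunE regZE mulrA.
under eq_bigr => B _ do rewrite -mulr_suml.
by rewrite -mulr_suml X0 mul0r.
Qed.

Lemma slice2_sum_tens_eq0 k (X : 'I_k.+2 -> 'M[C]_2) (phi : spin k.+2)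
    (u : 'I_2 -> 'I_2 -> C) :
  (forall B D, \sum_P \sum_Q u P Q * (X ord0 P B * X (lift ord0 ord0) Q D) = 0) ->
  \sum_P \sum_Q u P Q *: slice2 (tens X phi) P Q = 0.
Proof.
move=> X0; apply/ffunP => A; rewrite sum_ffunE ffunE.
under eq_bigr => P _ do rewrite sum_ffunE.
under eq_bigr => P _ do under eq_bigr => Q _ do
  rewrite ffunE [in X in _ *: X]ffunE tens_cons2 regZE.
transitivity (\sum_P \sum_Q \sum_B \sum_D u P Q * (X ord0 P B * X (lift ord0 ord0) Q D) *
   tens (fun i => X (lift ord0 (lift ord0 i))) (slice2 phi B D) A).
  apply: eq_bigr => P _; apply: eq_bigr => Q _; rewrite mulr_sumr.
  apply: eq_bigr => B _; rewrite mulr_sumr; apply: eq_bigr => D _.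
  by rewrite mulrA.
under eq_bigr => P _ do (rewrite exchange_big; under eq_bigr => B _ do rewrite exchange_big).
rewrite exchange_big big1 // => B _ /=; rewrite exchange_big big1 // => D _ /=.
under eq_bigr => P _ do rewrite -mulr_suml.
by rewrite -mulr_suml X0 mul0r.
Qed.

End EllipticComplex.

(** * Exactness of the symbol sequence *)

Section Exactness.
Variables (R : realType) (xi : 'rV[R]_3).
Local Notation C := R[i].
Local Notation spin := (spinor C^o).
Local Notation pd := (xi_mul xi).
Local Notation M := (xi_mix xi).

Lemma slice2B k (phi psi : spin k.+2) B D :
  slice2 (phi - psi) B D = slice2 phi B D - slice2 psi B D.
Proof. by apply/ffunP => A; rewrite !ffunE. Qed.

Lemma slice2Z k e (phi : spin k.+2) B D : slice2 (e *: phi) B D = e *: slice2 phi B D.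
Proof. by apply/ffunP => A; rewrite !ffunE. Qed.

Lemma divergenceZ k e (phi : spin k.+2) : symmetric_spinor phi ->
  divergence pd (e *: phi) = e *: divergence pd phi.
Proof.
move=> sphi; rewrite !divergence_slice2 //; last exact: symmetricZ.
rewrite scaler_sumr; apply: eq_bigr => B _; rewrite scaler_sumr.
by apply: eq_bigr => D _; rewrite slice2Z !scalerA mulrC.
Qed.

Lemma outer2D k d (phi psi : spin k) :
  outer2 d (phi + psi) = outer2 d phi + outer2 d psi.
Proof. by apply/ffunP => A; rewrite !ffunE mulrDr. Qed.

Lemma outer2Z k d e (phi : spin k) : outer2 d (e *: phi) = e *: outer2 d phi.
Proof. by apply/ffunP => A; rewrite !ffunE !regZE mulrCA. Qed.

Lemma twistorD k (phi psi : spin k) :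
  twistor pd (phi + psi) = twistor pd phi + twistor pd psi.
Proof. by rewrite !twistor_outer2 outer2D symmetrizeD. Qed.

Lemma twistorZ k e (phi : spin k) : twistor pd (e *: phi) = e *: twistor pd phi.
Proof. by rewrite !twistor_outer2 outer2Z symmetrizeZ. Qed.

Lemma twistor_sum k (I : finType) (F : I -> spin k) :
  twistor pd (\sum_i F i) = \sum_i twistor pd (F i).
Proof.
apply: (big_morph _ (@twistorD k)).
by rewrite -[X in twistor _ X](scale0r 0) twistorZ scale0r.
Qed.

Lemma permute_tuple_lift k (T : Type) (s : 'S_k) x (A : k.-tuple T) :
  permute_tuple (lift_perm ord0 ord0 s) [tuple of x :: A] = [tuple of x :: permute_tuple s A].
Proof.
apply: eq_from_tnth => i; rewrite tnth_mktuple.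
case: (unliftP ord0 i) => [j|] ->; first by rewrite lift_perm_lift !tnthS tnth_mktuple.
by rewrite lift_perm_id !tnth0.
Qed.

(** A permutation of the [k] inner indices extends to one of all [k + 2] fixing the first two, and
    the outer symmetrization absorbs it. *)
Lemma twistor_symmetrize k (phi : spin k) :
  twistor pd (symmetrize phi) = twistor pd phi.
Proof.
have -> : symmetrize phi = (k`!%:R : C)^-1 *:
    \sum_(s : 'S_k) [ffun A => phi (permute_tuple s A)].
  apply/ffunP => A; rewrite !ffunE; congr (_ *: _); rewrite sum_ffunE.
  by apply: eq_bigr => s _; rewrite ffunE.
rewrite twistorZ twistor_sum.
rewrite (eq_bigr (fun=> twistor pd phi)) => [|s _]; last first.
  rewrite !twistor_outer2.
  rewrite -[RHS](symmetrize_permute _ (lift_perm ord0 ord0 (lift_perm ord0 ord0 s))).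
  congr symmetrize; apply/ffunP => A; case/tupleP: A => P A; case/tupleP: A => Q A.
  rewrite [RHS]ffunE (permute_tuple_lift (lift_perm _ _ _)) permute_tuple_lift.
  by rewrite !outer2_cons2 ffunE.
rewrite sumr_const card_Sn -[X in _ *: X]scaler_nat scalerA mulVf ?scale1r //.
Qed.

Section Root.
Variable r : C.
Hypotheses (r0 : r != 0) (r2 : r ^+ 2 = xi_sq xi).
Local Notation N := (r%:M + M).
Local Notation N' := ((- r)%:M + M).

Let r2N : (- r) ^+ 2 = xi_sq xi. Proof. by rewrite sqrrN. Qed.

Let rr0 : 2 * r != 0. Proof. by rewrite mulf_neq0 // pnatr_eq0. Qed.

Lemma tens_shift_mix_twistor (s : C) k (phi : spin k) : s ^+ 2 = xi_sq xi ->
  tens (fun=> s%:M + M) (twistor pd phi) = 0.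
Proof.
move=> s2; rewrite twistor_outer2 -symmetrize_tens tens_outer2_eq0 ?symmetrize0 //.
exact: shift_mix_down.
Qed.

Lemma calG_twistor_symb k (phi : spin k) : calG pd (twistor pd phi) = 0.
Proof.
apply: (scalerI rr0); rewrite scaler0 calG_symb //; last exact: twistor_sym.
by rewrite !tens_shift_mix_twistor // subrr.
Qed.

Lemma divergence_calG_symb k (phi : spin k.+2) : symmetric_spinor phi ->
  divergence pd (calG pd phi) = 0.
Proof.
move=> sphi; apply: (scalerI rr0); rewrite scaler0 -divergenceZ; last exact: calG_sym.
rewrite divergence_slice2; last by apply/symmetricZ/calG_sym.
rewrite calG_symb //.
under eq_bigr => P _ do under eq_bigr => Q _ do rewrite slice2B scalerBr.
under eq_bigr => P _ do rewrite sumrB.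
have z s : s ^+ 2 = xi_sq xi ->
    \sum_P \sum_Q xi_up xi P Q *: slice2 (tens (fun=> s%:M + M) phi) P Q = 0.
  by move=> s2; apply: slice2_sum_tens_eq0 => B D; exact: shift_mix_up.
apply: etrans (sumrB _ _ _ _) _.
transitivity (0 - 0 : spin k); last exact: subrr.
by congr (_ - _); [exact: (z _ r2) | exact: (z _ r2N)].
Qed.

(** One notion for both kernels: the kernel of [calG] uses that [chi] lies in the image of the
    twistor symbol, the kernel of the divergence that [chi] then vanishes. *)
Definition twistor_remainder k (phi chi : spin k.+2) :=
  exists2 eta : spin k, symmetric_spinor eta /\ (divergence pd phi = 0 -> eta = 0)
    & chi = twistor pd eta.

(** Under symmetrization the first two factors may be exchanged, so twice the term contains
    [- (N (x) N' + N' (x) N)] there, and [shift_mix_anticomm] extracts [xi_{PQ}] and the divergence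
    of [phi]. Hence [eta] is minus the divergence acted on by the remaining factors, then
    symmetrized, which does not affect its twistor image. *)
Lemma twistor_remainder_tens k (phi : spin k.+2) (X : 'I_k.+2 -> 'M[C]_2) :
  symmetric_spinor phi -> X ord0 = N -> X (lift ord0 ord0) = - N' ->
  twistor_remainder phi (symmetrize (tens X phi)).
Proof.
move=> sphi X0 X1; pose X2 i := X (lift ord0 (lift ord0 i)).
exists (symmetrize (- tens X2 (divergence pd phi))).
  split; first exact: symmetrize_sym.
  by move=> ->; rewrite -[X in tens _ X](scale0r 0) tensZ scale0r oppr0 symmetrize0.
rewrite twistor_symmetrize twistor_outer2.
have two0 : (2 : C) != 0 by rewrite pnatr_eq0.
apply: (scalerI two0).
pose t : 'S_k.+2 := tperm ord0 (lift ord0 ord0).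
have eS := symmetrize_tens_permute X t sphi.
apply: etrans (scaler_nat _ _) _; rewrite mulr2n.
transitivity (symmetrize (tens X phi) + symmetrize (tens (fun i => X (t i)) phi)).
  exact: (congr2 +%R erefl (esym eS)).
apply: etrans (esym (symmetrizeD _ _)) _; apply: etrans _ (symmetrizeZ _ _).
congr symmetrize.
apply/ffunP => A; case/tupleP: A => P A; case/tupleP: A => Q A.
transitivity (tens X phi [tuple of P :: [tuple of Q :: A]] +
  tens (fun i => X (t i)) phi [tuple of P :: [tuple of Q :: A]]); first by rewrite ffunE.
rewrite [RHS]ffunE outer2_cons2 regZE !tens_cons2 divergence_slice2 //.
rewrite tpermL tpermR X0 X1.
pose x B D := tens X2 (slice2 phi B D) A.
have xC : x 1 0 = x 0 1.
  congr (tens _ _ A); apply/ffunP => A'; rewrite !ffunE.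
  apply: symmetric_perm_eq => //=.
  by rewrite (perm_catCA [:: _] [:: _]).
have eX2 i : X (t (lift ord0 (lift ord0 i))) = X2 i by rewrite tpermD.
have opp_mx (L : 'M[C]_2) B D : (- L) B D = - L B D by rewrite mxE.
have -> : (- tens X2 (\sum_B \sum_D xi_up xi B D *: slice2 phi B D)) A =
    - \sum_B \sum_D xi_up xi B D * x B D.
  rewrite ffunE; congr (- _); rewrite tens_sum sum_ffunE; apply: eq_bigr => B _.
  rewrite tens_sum sum_ffunE; apply: eq_bigr => D _.
  by rewrite tensZ ffunE regZE.
rewrite mulrA mulrN -(shift_mix_anticomm r2 P Q xC) -big_split -sumrN /=.
apply: eq_bigr => B _; rewrite -big_split -sumrN /=; apply: eq_bigr => D _.
rewrite (eq_tens _ eX2) !opp_mx -/(x B D).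
move: (N P B) (N' P B) (N Q D) (N' Q D) (x B D) => n1 n2 n3 n4 y.
ring.
Qed.

Lemma twistor_remainderD k (phi chi1 chi2 : spin k.+2) :
  twistor_remainder phi chi1 -> twistor_remainder phi chi2 ->
  twistor_remainder phi (chi1 + chi2).
Proof.
move=> [eta1 [s1 z1] ->] [eta2 [s2 z2] ->]; exists (eta1 + eta2); last by rewrite twistorD.
by split; [exact: symmetricD | move=> d0; rewrite z1 // z2 // addr0].
Qed.

Lemma twistor_remainder0 k (phi : spin k.+2) : twistor_remainder phi 0.
Proof.
exists 0; first by split=> // s A; rewrite !ffunE.
by rewrite -[X in twistor _ X](scale0r 0) twistorZ scale0r.
Qed.

Lemma twistor_remainder_mixed k (phi : spin k.+2) (X : 'I_k.+2 -> 'M[C]_2) i j :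
  symmetric_spinor phi -> i != j -> X i = N -> X j = - N' ->
  twistor_remainder phi (symmetrize (tens X phi)).
Proof.
(* The permutation [s] takes the first index to [i] and the second to [j]: the transposition
   following [t] moves the image of the second index to [j] and fixes [i]. *)
move=> sphi neij Xi Xj; pose t := tperm ord0 i.
pose s := (t * tperm (t (lift ord0 ord0)) j)%g.
rewrite -(symmetrize_tens_permute X s sphi).
have s0 : s ord0 = i.
  rewrite permM tpermL tpermD // 1?eq_sym // -(tpermL ord0 i) -/t.
  by rewrite (inj_eq perm_inj).
have s1 : s (lift ord0 ord0) = j by rewrite permM tpermL.
by apply: twistor_remainder_tens; rewrite ?s0 ?s1.
Qed.

Lemma twistor_remainder_decomp k (phi : spin k.+2) : symmetric_spinor phi ->
  twistor_remainder phi ((2 * r) ^+ k.+2 *: phi -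
    (tens (fun=> N) phi + (-1) ^+ k.+2 *: tens (fun=> N') phi)).
Proof.
move=> sphi.
have e2r : (2 * r)%:M = N + - N' :> 'M[C]_2.
  by rewrite opprD addrACA subrr addr0 -raddfB opprK mulr2n mulrDl !mul1r.
have E : (2 * r) ^+ k.+2 *: phi =
    \sum_(J : {set 'I_k.+2}) symmetrize (tens (fun i => if i \in J then N else - N') phi).
  rewrite -symmetrize_sum -tens_expand -e2r symmetrize_id; last exact: tens_sym.
  have -> : tens (fun=> (2 * r)%:M) phi =
      tens (fun i : 'I_k.+2 => (2 * r) *: 1%:M) phi.
    by apply: eq_tens => i; rewrite scalemx1.
  by rewrite (tens_scale (fun=> 2 * r)) prodr_const card_ord tens1.
(* The full and the empty set give the two pure terms; every other [J] has both a member and a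
   non-member, so its term is mixed. *)
rewrite E (bigD1 [set: 'I_k.+2]%SET) //= (bigD1 finset.set0) /=; last first.
  by rewrite eq_sym -card_gt0 cardsT card_ord.
have -> : symmetrize (tens (fun i => if i \in [set: 'I_k.+2]%SET then N else - N') phi) =
    tens (fun=> N) phi.
  rewrite -[RHS]symmetrize_id; last exact: tens_sym.
  by congr symmetrize; apply: eq_tens => i; rewrite finset.in_setT.
have -> : symmetrize (tens (fun i => if i \in finset.set0 then N else - N') phi) =
    (-1) ^+ k.+2 *: tens (fun=> N') phi.
  rewrite -[RHS]symmetrize_id; last exact/symmetricZ/tens_sym.
  rewrite -[X in (-1) ^+ X](card_ord k.+2) -prodr_const -tens_scale.
  by congr symmetrize; apply: eq_tens => i; rewrite finset.in_set0 scaleN1r.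
have cancel (x y z : spin k.+2) : x + (y + z) - (x + y) = z.
  by rewrite addrA [x + y + z]addrC addrK.
rewrite cancel.
apply: (big_ind (twistor_remainder phi)); first exact: twistor_remainder0.
  exact: twistor_remainderD.
move=> J /andP[JT J0].
have [i iJ] := finset.set0Pn _ J0.
have [j jJ] : exists j, j \notin J.
  by apply/existsP; move: JT; apply: contraNT => /existsPn JT; apply/eqP/finset.setP => j;
    rewrite finset.in_setT; apply/negPn/JT.
apply: (twistor_remainder_mixed (i := i) (j := j)) => //.
- by apply: contraNneq jJ => <-.
- by rewrite iJ.
- by rewrite (negPf jJ).
Qed.

Lemma tens_mx0 k (phi : spin k.+1) : tens (fun=> 0) phi = 0.
Proof. exact: (@tens_eq0 _ _ _ ord0). Qed.

Lemma tens_shift_mix_idem (s : C) k (phi : spin k) : s ^+ 2 = r ^+ 2 ->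
  tens (fun=> s%:M + M) (tens (fun=> s%:M + M) phi) =
  (2 * s) ^+ k *: tens (fun=> s%:M + M) phi.
Proof.
move=> s2; rewrite tensM -[k in X in X *: _](card_ord k) -prodr_const -tens_scale.
by apply: eq_tens => i; rewrite (shift_mix_idem r2).
Qed.

Lemma ker_calG_symb k (phi : spin k.+2) : symmetric_spinor phi ->
  calG pd phi = 0 -> exists2 eta : spin k, symmetric_spinor eta & twistor pd eta = phi.
Proof.
move=> sphi G0.
have eN : tens (fun=> N) phi = tens (fun=> N') phi.
  by apply/eqP; rewrite -subr_eq0 -calG_symb // G0 scaler0.
(* Applying the tensor power of [N] once more to both sides of [eN] gives [(2 r) ^ (k + 2)] times
   this tensor on one side and, since [N N' = 0], zero on the other. *)
have N0 : tens (fun=> N) phi = 0.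
  have := tens_shift_mix_idem phi (erefl (r ^+ 2)).
  rewrite {1}eN tensM (eq_tens _ (fun=> shift_mixMN r2)).
  by rewrite tens_mx0 => /esym/eqP; rewrite scaler_eq0 expf_eq0 (negPf rr0) => /eqP.
have [eta [seta _]] := twistor_remainder_decomp sphi.
rewrite -eN N0 scaler0 addr0 subr0 => e.
exists ((2 * r) ^- k.+2 *: eta); first exact: symmetricZ.
by rewrite twistorZ -e scalerA mulVf ?scale1r // expf_neq0.
Qed.

Lemma ker_divergence_symb k (phi : spin k.+2) : symmetric_spinor phi ->
  divergence pd phi = 0 -> exists2 psi : spin k.+2, symmetric_spinor psi & calG pd psi = phi.
Proof.
move=> sphi d0.
have [eta [_ /(_ d0) ->]] := twistor_remainder_decomp sphi.
(* With [eta = 0] the decomposition writes [(2 r) ^ (k + 2) phi] as the two pure terms alone. *)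
rewrite -[X in twistor _ X](scale0r 0) twistorZ scale0r => /eqP.
rewrite subr_eq0 => /eqP e.
have hG := calG_symb sphi r2.
have NN' : tens (fun=> N) (tens (fun=> N') phi) = 0.
  by rewrite tensM (eq_tens _ (fun=> shift_mixMN r2)) tens_mx0.
have N'N : tens (fun=> N') (tens (fun=> N) phi) = 0.
  by rewrite tensM (eq_tens _ (fun=> shift_mixNM r2)) tens_mx0.
have TN : (2 * r) *: tens (fun=> N) (calG pd phi) = (2 * r) ^+ k.+2 *: tens (fun=> N) phi.
  rewrite -tensZ hG tensB NN' subr0.
  exact: tens_shift_mix_idem.
have TN' : (2 * r) *: tens (fun=> N') (calG pd phi) =
    - ((2 * r) ^+ k.+2 *: ((-1) ^+ k.+2 *: tens (fun=> N') phi)).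
  rewrite -tensZ hG tensB N'N sub0r; congr (- _).
  apply: etrans (tens_shift_mix_idem _ (sqrrN r)) _.
  by rewrite scalerA -exprMn mulrN mulrN1.
(* The minus sign of [calG_symb] and the one in [TN'] cancel, so the pure terms recombine to [phi]
   by [e]. *)
have GG : (2 * r) ^+ 2 *: calG pd (calG pd phi) = ((2 * r) ^+ k.+2) ^+ 2 *: phi.
  rewrite [in LHS]expr2 -scalerA (calG_symb (calG_sym pd _) r2) scalerBr TN TN' opprK.
  by rewrite -scalerDr [in RHS]expr2 -[in RHS]scalerA e.
(* The scalar is the one that [GG] forces. *)
exists ((2 * r) ^- k.+2 ^+ 2 * (2 * r) ^+ 2 *: calG pd phi).
  by apply/symmetricZ/calG_sym.
(* The scalar is pulled out of [calG] by passing through the tensor form, which is visibly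
   linear. *)
apply: (scalerI rr0); rewrite (calG_symb (symmetricZ _ (calG_sym pd _)) r2).
rewrite !tensZ -scalerBr -(calG_symb (calG_sym pd _) r2).
rewrite scalerA mulrC -scalerA; congr (_ *: _).
by rewrite -scalerA GG scalerA -exprMn mulVf ?expr1n ?scale1r // expf_neq0.
Qed.

End Root.
End Exactness.

(** * Symmetry of mixed directional derivatives *)

Section MixedPartials.
Variables (R : realType) (V : normedModType R).
Implicit Types (f : V -> R) (x u v : V).

Lemma is_derive_line f x u t : derivable f (x + t *: u) u ->
  is_derive t 1 (fun s : R => f (x + s *: u)) ('D_u f (x + t *: u)).
Proof.
pose g (s : R) := f (x + s *: u).
have E : (fun h : R => h^-1 *: ((g \o shift t) (h *: 1) - g t)) =
    (fun h : R => h^-1 *: ((f \o shift (x + t *: u)) (h *: u) - f (x + t *: u))).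
  apply/funext => h /=; rewrite /g; congr (_ *: (f _ - _)).
  have -> : h *: 1 = h :> R by exact: mulr1.
  by rewrite scalerDl addrCA addrC -?addrA.
by move=> df; split; rewrite /derivable /derive -/g E.
Qed.

(** The mean value theorem is applied twice: along [u] to the difference of [f] on two parallel
    lines, then along [v] to ['D_u f]. *)
Lemma mixed_difference f x u v h : (forall y, derivable f y u) ->
  (forall y, derivable ('D_u f) y v) -> 0 < h ->
  exists c d, [/\ 0 < c < h, 0 < d < h &
    f (x + h *: v + h *: u) - f (x + h *: u) - (f (x + h *: v) - f x) =
    'D_v ('D_u f) (x + c *: u + d *: v) * h * h].
Proof.
move=> fu fuv h0.
pose F s := f (x + h *: v + s *: u) - f (x + s *: u).
pose dF s := 'D_u f (x + h *: v + s *: u) - 'D_u f (x + s *: u).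
have FdF (s : R) : is_derive s 1 F (dF s).
  by apply: is_deriveB; apply: is_derive_line.
have [|c c0h] := MVT h0 (fun s _ => FdF s).
  by apply: derivable_within_continuous => s _; have [] := FdF s.
rewrite {1 2}/F !scale0r !addr0 subr0 => ->.
have gd (s : R) : is_derive s 1 (fun s : R => 'D_u f (x + c *: u + s *: v))
    ('D_v ('D_u f) (x + c *: u + s *: v)).
  exact: is_derive_line.
have [|d d0h] := MVT h0 (fun s _ => gd s).
  by apply: derivable_within_continuous => s _; have [] := gd s.
rewrite scale0r addr0 subr0 => e; exists c, d; split; [by []|by []|].
by rewrite -e /dF addrAC.
Qed.

(** Schwarz's theorem. The second difference is symmetric in [u] and [v], so the two mixed
    derivatives agree at some pair of points near [x]; by continuity they cannot differ at [x]. *)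
Lemma derive_comm f x u v :
  (forall y, derivable f y u) -> (forall y, derivable f y v) ->
  (forall y, derivable ('D_u f) y v) -> (forall y, derivable ('D_v f) y u) ->
  {for x, continuous ('D_v ('D_u f))} -> {for x, continuous ('D_u ('D_v f))} ->
  'D_v ('D_u f) x = 'D_u ('D_v f) x.
Proof.
move=> fu fv fuv fvu cuv cvu; apply/eqP; apply/negPn/negP => neq.
set a := 'D_v _ x in neq; set b := 'D_u _ x in neq.
(* Half the gap: a common value cannot be within [e] of both [a] and [b]. *)
pose e := `|a - b| / 2.
have e0 : 0 < e by rewrite divr_gt0 // normr_gt0 subr_eq0.
have [/= d1 d1_gt0 H1] : nbhs_ball x [set y | `|a - 'D_v ('D_u f) y| < e].
  by rewrite nbhs_ballE; move/cvgrPdist_lt : cuv; apply.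
have [/= d2 d2_gt0 H2] : nbhs_ball x [set y | `|b - 'D_u ('D_v f) y| < e].
  by rewrite nbhs_ballE; move/cvgrPdist_lt : cvu; apply.
pose d := Num.min d1 d2; have d_gt0 : 0 < d by rewrite lt_min d1_gt0.
(* The summand [1] keeps [n] positive when [u = v = 0] and makes [h (|u| + |v|) < d] strict. *)
pose n := `|u| + `|v| + 1; have n_gt0 : 0 < n by rewrite ltr_wpDl ?addr_ge0.
pose h := d / n; have h_gt0 : 0 < h by rewrite divr_gt0.
have small s t : 0 < s < h -> 0 < t < h -> `|s *: u + t *: v| < d.
  move=> /andP[s0 sh] /andP[t0 th]; apply: (@le_lt_trans _ _ (h * (`|u| + `|v|))).
    rewrite mulrDr (le_trans (ler_normD _ _)) // !normrZ !gtr0_norm //.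
    by rewrite lerD // ler_wpM2r // ltW.
  by rewrite /h -mulrA gtr_pMr // mulrC ltr_pdivrMr // mul1r ltrDl.
have [s1 [t1 [s1h t1h E1]]] := mixed_difference x fu fuv h_gt0.
have [s2 [t2 [s2h t2h E2]]] := mixed_difference x fv fvu h_gt0.
have {}H1 : `|a - 'D_v ('D_u f) (x + s1 *: u + t1 *: v)| < e.
  apply: H1; rewrite -ball_normE /= -addrA opprD addNKr normrN.
  by rewrite (lt_le_trans (small _ _ s1h t1h)) // ge_min lexx.
have {}H2 : `|b - 'D_u ('D_v f) (x + s2 *: v + t2 *: u)| < e.
  apply: H2; rewrite -ball_normE /= -addrA opprD addNKr normrN addrC.
  by rewrite (lt_le_trans (small _ _ t2h s2h)) // ge_min lexx orbT.
have E : 'D_v ('D_u f) (x + s1 *: u + t1 *: v) = 'D_u ('D_v f) (x + s2 *: v + t2 *: u).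
  apply: (mulIf (lt0r_neq0 h_gt0)); apply: (mulIf (lt0r_neq0 h_gt0)).
  apply: etrans (esym E1) _; apply: etrans _ E2; rewrite (addrAC x).
  by rewrite !opprD !opprK !addrA [X in X + f x]addrAC.
rewrite E in H1; rewrite distrC in H2.
have := ltrD H1 H2; rewrite -splitr => /(le_lt_trans (ler_distD _ a b)).
by rewrite ltxx.
Qed.

End MixedPartials.

(** * Smooth functions as a complex vector space with commuting partial derivatives *)

Section Smooth.
Variable R : realType.
Local Notation V := 'rV[R]_3.
Implicit Types (f g : V -> R).

Lemma iter_partialD l f g : real_smooth f -> real_smooth g ->
  foldr (@real_partial R) (f + g) l =
  foldr (@real_partial R) f l + foldr (@real_partial R) g l.
Proof.
move=> sf sg; elim: l => //= i l ->; apply/funext => x.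
by rewrite /real_partial deriveD //; [have [_] := sf l | have [_] := sg l].
Qed.

Lemma iter_partialZ l (k : R) f : real_smooth f ->
  foldr (@real_partial R) (k *: f) l = k *: foldr (@real_partial R) f l.
Proof.
move=> sf; elim: l => //= i l ->; apply/funext => x.
by rewrite /real_partial (@deriveZ _ _ _ _ k) //; have [_] := sf l.
Qed.

Lemma real_smoothD f g : real_smooth f -> real_smooth g -> real_smooth (f + g).
Proof.
move=> sf sg l; rewrite /= iter_partialD //; have [cf df] := sf l; have [cg dg] := sg l.
split; first by move=> x; apply: continuousD; [exact: cf | exact: cg].
by move=> i x; apply: derivableD.
Qed.

Lemma real_smoothZ (k : R) f : real_smooth f -> real_smooth (k *: f).
Proof.
move=> sf l; rewrite /= iter_partialZ //; have [cf df] := sf l.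
split; first by move=> x; apply: continuousZr; exact: cf.
by move=> i x; apply: derivableZ.
Qed.

Lemma real_smooth_partial i f : real_smooth f -> real_smooth (real_partial i f).
Proof. by move=> sf l; have := sf (rcons l i); rewrite foldr_rcons. Qed.

Lemma real_partial_comm i j f : real_smooth f ->
  real_partial i (real_partial j f) = real_partial j (real_partial i f).
Proof.
move=> sf; apply/funext => x.
have D := proj2 (sf [::]); have Di := proj2 (sf [:: i]); have Dj := proj2 (sf [:: j]).
exact: (derive_comm (D j) (D i) (Dj i) (Di j) (proj1 (sf [:: i; j]) x)
  (proj1 (sf [:: j; i]) x)).
Qed.

Local Notation W := (V -> R[i]^o).
Implicit Types (F G : W).

Lemma smooth0 : smooth (0 : W).
Proof.
have s0 : real_smooth (0 : V -> R).
  have E l : foldr (@real_partial R) 0 l = 0.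
    by elim: l => //= i l ->; apply/funext => x; rewrite /real_partial derive_cst.
  by move=> l; rewrite /= E; split=> [|i x]; [exact: cst_continuous | exact: derivable_cst].
by split; exact: s0.
Qed.

Lemma Re_compD F G :
  @complex.Re R \o (F + G) = (@complex.Re R \o F) + (@complex.Re R \o G).
Proof. by apply/funext => x; exact: (raddfD (@complex.Re R)). Qed.

Lemma Im_compD F G :
  @complex.Im R \o (F + G) = (@complex.Im R \o F) + (@complex.Im R \o G).
Proof. by apply/funext => x; exact: (raddfD (@complex.Im R)). Qed.

Lemma Re_compZ (a b : R) F : @complex.Re R \o ((a +i* b) *: F) =
  a *: (@complex.Re R \o F) + (- b) *: (@complex.Im R \o F).
Proof.
apply/funext => x; change (complex.Re ((a +i* b) * F x) =
  a * complex.Re (F x) + - b * complex.Im (F x)).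
by case: (F x) => y z; rewrite mulNr.
Qed.

Lemma Im_compZ (a b : R) F : @complex.Im R \o ((a +i* b) *: F) =
  a *: (@complex.Im R \o F) + b *: (@complex.Re R \o F).
Proof.
apply/funext => x; change (complex.Im ((a +i* b) * F x) =
  a * complex.Im (F x) + b * complex.Re (F x)).
by case: (F x).
Qed.

Lemma smoothD F G : smooth F -> smooth G -> smooth (F + G).
Proof.
move=> [rF iF] [rG iG].
by split; rewrite ?Re_compD ?Im_compD; exact: real_smoothD.
Qed.

Lemma smoothZ (c : R[i]) F : smooth F -> smooth (c *: F).
Proof.
move=> [rF iF]; case: c => a b.
by split; rewrite ?Re_compZ ?Im_compZ; apply: real_smoothD; exact: real_smoothZ.
Qed.

Lemma smooth_partial i F : smooth F -> smooth (partial i F).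
Proof. by move=> [rF iF]; split; exact: real_smooth_partial. Qed.

Lemma real_partialD i f g : real_smooth f -> real_smooth g ->
  real_partial i (f + g) = real_partial i f + real_partial i g.
Proof. exact: (iter_partialD [:: i]). Qed.

Lemma real_partialZ i k f : real_smooth f ->
  real_partial i (k *: f) = k *: real_partial i f.
Proof. exact: (iter_partialZ [:: i]). Qed.

Lemma partialD i F G : smooth F -> smooth G ->
  partial i (F + G) = partial i F + partial i G.
Proof.
move=> [rF iF] [rG iG]; apply/funext => x.
by rewrite /partial Re_compD Im_compD !real_partialD.
Qed.

Lemma partialZ i (c : R[i]) F : smooth F -> partial i (c *: F) = c *: partial i F.
Proof.
move=> [rF iF]; case: c => a b; apply/funext => x.
have eR : real_partial i (@complex.Re R \o ((a +i* b) *: F)) =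
    a *: real_partial i (@complex.Re R \o F) + - b *: real_partial i (@complex.Im R \o F).
  rewrite Re_compZ real_partialD; [|exact: real_smoothZ|exact: real_smoothZ].
  exact: (congr2 +%R (real_partialZ _ _ rF) (real_partialZ _ _ iF)).
have eI : real_partial i (@complex.Im R \o ((a +i* b) *: F)) =
    a *: real_partial i (@complex.Im R \o F) + b *: real_partial i (@complex.Re R \o F).
  rewrite Im_compZ real_partialD; [|exact: real_smoothZ|exact: real_smoothZ].
  exact: (congr2 +%R (real_partialZ _ _ iF) (real_partialZ _ _ rF)).
apply: etrans (congr2 (@Complex R) (congr1 (@^~ x) eR) (congr1 (@^~ x) eI)) _.
change ((a * real_partial i (@complex.Re R \o F) x + - b * real_partial i (@complex.Im R \o F) x)
  +i* (a * real_partial i (@complex.Im R \o F) x + b * real_partial i (@complex.Re R \o F) x) =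
  (a +i* b) * partial i F x).
by rewrite mulNr.
Qed.

Lemma partial_comm i j F : smooth F -> partial i (partial j F) = partial j (partial i F).
Proof.
move=> [rF iF]; apply/funext => x.
exact: (congr2 (@Complex R) (congr1 (@^~ x) (real_partial_comm i j rF))
  (congr1 (@^~ x) (real_partial_comm i j iF))).
Qed.

Lemma partial0 i : partial i (0 : W) = 0.
Proof. by rewrite -[X in partial i X](scale0r 0) partialZ ?scale0r //; exact: smooth0. Qed.

End Smooth.

(** * Polynomials in an operator, with coefficients acting through [F] *)

Section PolynomialAction.
Variables (K : nzRingType) (V : zmodType) (F : K -> V -> V) (T : V -> V).
Hypothesis FD : forall c d w, F (c + d) w = F c w + F d w.

(** The polynomial [p] evaluated at the operator [T]. The coefficient action [F] may itself be of
    this form, so that nesting handles several variables. *)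
Definition polyact (p : {poly K}) (w : V) : V := \sum_(i < size p) F p`_i (iter i T w).

Let F0 w : F 0 w = 0.
Proof. by apply: (addrI (F 0 w)); rewrite -FD !addr0. Qed.

Lemma polyact_widen n (p : {poly K}) w : (size p <= n)%N ->
  polyact p w = \sum_(i < n) F p`_i (iter i T w).
Proof.
move=> len; apply: (sum_ord_widen (F := fun i => F p`_i (iter i T w))) => // i lei.
by rewrite nth_default.
Qed.

Lemma polyactD (p q : {poly K}) w : polyact (p + q) w = polyact p w + polyact q w.
Proof.
pose n := maxn (size p) (size q).
rewrite (@polyact_widen n) ?size_polyD // (@polyact_widen n p) ?leq_maxl //.
rewrite (@polyact_widen n q) ?leq_maxr // -big_split; apply: eq_bigr => i _.
by rewrite coefD FD.
Qed.

Lemma polyactC c w : polyact c%:P w = F c w.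
Proof.
by rewrite (@polyact_widen 1) ?size_polyC_leq1 // big_ord1 coefC.
Qed.

Lemma polyactXM (p : {poly K}) w : polyact ('X * p) w = polyact p (T w).
Proof.
have sz : (size ('X * p)%R <= (size p).+1)%N.
  by rewrite (leq_trans (size_polyMleq _ _)) // size_polyX.
rewrite (polyact_widen _ sz) big_ord_recl coefXM eqxx F0 add0r.
by apply: eq_bigr => i _; rewrite coefXM /= -iterSr.
Qed.

Lemma polyactCM c (p : {poly K}) w w' : (forall i d, F (c * d) (iter i T w) = F d (iter i T w')) ->
  polyact (c%:P * p) w = polyact p w'.
Proof.
move=> Fc; rewrite (@polyact_widen (size p)); last first.
  by rewrite mul_polyC size_scale_leq.
by apply: eq_bigr => i _; rewrite coefCM Fc.
Qed.

Lemma polyactCM_additive c (p : {poly K}) w (G : V -> V) : G 0 = 0 -> {morph G : x y / x + y} ->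
  (forall d v, F (c * d) v = G (F d v)) -> polyact (c%:P * p) w = G (polyact p w).
Proof.
move=> G0 GD Fc; rewrite (@polyact_widen (size p)); last first.
  by rewrite mul_polyC size_scale_leq.
rewrite (big_morph G GD G0); apply: eq_bigr => i _.
by rewrite coefCM Fc.
Qed.

Section Domain.
Variable P : V -> Prop.
Hypotheses (P0 : P 0) (PD : forall v w, P v -> P w -> P (v + w))
  (PF : forall c w, P w -> P (F c w)) (PT : forall w, P w -> P (T w)).

Lemma polyact_closed (p : {poly K}) w : P w -> P (polyact p w).
Proof.
by move=> Pw; apply: (big_ind P) => // i _; apply: PF; exact: iter_closed.
Qed.

(** The conditions on [S] are restricted to the domain [P] because partial derivatives are additive
    and commute only under a smoothness assumption. *)
Lemma polyact_comm (S : V -> V) (p : {poly K}) w : S 0 = 0 ->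
  (forall v w, P v -> P w -> S (v + w) = S v + S w) ->
  (forall c w, P w -> S (F c w) = F c (S w)) ->
  (forall w, P w -> S (T w) = T (S w)) -> P w -> S (polyact p w) = polyact p (S w).
Proof.
move=> S0 SD SF ST Pw.
have Pi i : P (iter i T w) by exact: iter_closed.
suff [] : P (polyact p w) /\ S (polyact p w) = polyact p (S w) by [].
rewrite /polyact; elim/big_rec2: _ => // i y x _ [Px <-]; split.
  by apply: PD => //; exact: PF.
rewrite SD ?SF //; last exact: PF.
congr (F _ _ + _); elim: (nat_of_ord i) => //= n <-; exact: ST.
Qed.

End Domain.
End PolynomialAction.

(** * Passage from symbol identities to differential identities *)

Section Universal.
Variable R : realType.
Local Notation C := R[i].

(** The ring of polynomials in the three partial derivatives; coordinate [0] is the innermost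
    variable. A separate name carries the module structure over [C] rather than over the coefficient
    ring. *)
Definition poly3 := {poly {poly {poly C}}}.
HB.instance Definition _ := GRing.IntegralDomain.on poly3.

Definition poly3_scale (c : C) (p : poly3) : poly3 := c%:P%:P%:P * p.

Fact poly3_scaleA (a b : C) p : poly3_scale a (poly3_scale b p) = poly3_scale (a * b) p.
Proof. by rewrite /poly3_scale mulrA -!rmorphM. Qed.
Fact poly3_scale1 : left_id 1 poly3_scale.
Proof. by move=> p; rewrite /poly3_scale !rmorph1 mul1r. Qed.
Fact poly3_scaleDr : right_distributive poly3_scale +%R.
Proof. by move=> a p q; rewrite /poly3_scale mulrDr. Qed.
Fact poly3_scaleDl p : {morph poly3_scale^~ p : a b / a + b}.
Proof. by move=> a b; rewrite /poly3_scale !rmorphD mulrDl. Qed.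

HB.instance Definition _ := GRing.Zmodule_isLmodule.Build C poly3
  poly3_scaleA poly3_scale1 poly3_scaleDr poly3_scaleDl.

Definition poly3_var (i : 'I_3) : poly3 := nth 0 [:: 'X%:P%:P; 'X%:P; 'X] i.

Definition poly3_eval (x y z : nat) (p : poly3) : C := p.[z%:R].[y%:R].[x%:R].

Lemma poly_nat_eq0 (K : idomainType) (p : {poly K}) :
  injective (fun n : nat => n%:R : K) -> (forall n : nat, p.[n.+1%:R] = 0) -> p = 0.
Proof.
move=> injK p0; apply: (@roots_geq_poly_eq0 _ p [seq n.+1%:R | n <- iota 0 (size p)]).
- by apply/allP => _ /mapP[n _ ->]; apply/rootP.
- by rewrite map_inj_uniq ?iota_uniq // => m n /injK[].
- by rewrite size_map size_iota.
Qed.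

(** One variable at a time, a polynomial with infinitely many roots is zero. Restricting to positive
    integers keeps the covector nonzero, as the symbol identities demand. *)
Lemma poly3_eval_eq0 (p : poly3) :
  (forall x y z, poly3_eval x.+1 y.+1 z.+1 p = 0) -> p = 0.
Proof.
move=> p0.
have inj0 : injective (fun n : nat => n%:R : C).
  by move=> m n /eqP; rewrite eqr_nat => /eqP.
have inj1 : injective (fun n : nat => n%:R : {poly C}).
  by move=> m n e; apply: inj0; apply: polyC_inj; rewrite !polyC_natr.
have inj2 : injective (fun n : nat => n%:R : {poly {poly C}}).
  by move=> m n e; apply: inj1; apply: polyC_inj; rewrite !polyC_natr.
apply: (@poly_nat_eq0 _ _ inj2) => z; apply: (poly_nat_eq0 inj1) => y.
by apply: (@poly_nat_eq0 _ _ inj0) => x; exact: p0.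
Qed.

Lemma poly3_evalM x y z p q :
  poly3_eval x y z (p * q) = poly3_eval x y z p * poly3_eval x y z q.
Proof. by rewrite /poly3_eval !hornerM. Qed.

Lemma poly3_evalD x y z p q :
  poly3_eval x y z (p + q) = poly3_eval x y z p + poly3_eval x y z q.
Proof. by rewrite /poly3_eval !hornerD. Qed.

Lemma poly3_evalZ x y z c (p : poly3) : poly3_eval x y z (c *: p) = c * poly3_eval x y z p.
Proof. by rewrite [c *: p]/(_ * p) poly3_evalM /poly3_eval !hornerC. Qed.

Definition covector (x y z : nat) : 'rV[R]_3 := \row_i (nth 0%N [:: x; y; z] i)%:R.

Lemma poly3_eval_var x y z i :
  poly3_eval x y z (poly3_var i) = (covector x y z 0 i)%:C.
Proof.
rewrite mxE /poly3_eval /poly3_var rmorph_nat.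
by case: i => [[|[|[|//]]] lti] /=; rewrite !(hornerC, hornerX) -?polyC_natr ?hornerC.
Qed.

Local Notation W := ('rV[R]_3 -> C^o).

Definition poly3_act : poly3 -> W -> W :=
  polyact (polyact (polyact (fun (c : C) (w : W) => c *: w) (partial 0)) (partial 1))
    (partial 2).

Let F0 (c : C) (w : W) := c *: w.
Let F1 := polyact F0 (partial 0).
Let F2 := polyact F1 (partial 1).

Let F0D c d w : F0 (c + d) w = F0 c w + F0 d w. Proof. exact: scalerDl. Qed.
Let F1D p q w : F1 (p + q) w = F1 p w + F1 q w. Proof. exact: polyactD. Qed.
Let F2D p q w : F2 (p + q) w = F2 p w + F2 q w. Proof. exact: polyactD. Qed.

Let F1s p w : smooth w -> smooth (F1 p w).
Proof.
by apply: polyact_closed; [exact: smooth0 | exact: smoothD | exact: smoothZ | exact: smooth_partial].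
Qed.

Let F2s p w : smooth w -> smooth (F2 p w).
Proof.
by apply: polyact_closed; [exact: smooth0 | exact: smoothD | exact: F1s | exact: smooth_partial].
Qed.

Let F1c i p w : smooth w -> partial i (F1 p w) = F1 p (partial i w).
Proof.
apply: (@polyact_comm _ _ F0 (partial 0) (@smooth R) _ _ _ _ (partial i) p w).
- exact: smooth0.
- exact: smoothD.
- exact: smoothZ.
- exact: smooth_partial.
- exact: partial0.
- exact: partialD.
- exact: partialZ.
- by move=> ? ?; exact: partial_comm.
Qed.

Let F2c i p w : smooth w -> partial i (F2 p w) = F2 p (partial i w).
Proof.
apply: (@polyact_comm _ _ F1 (partial 1) (@smooth R) _ _ _ _ (partial i) p w).
- exact: smooth0.
- exact: smoothD.
- exact: F1s.
- exact: smooth_partial.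
- exact: partial0.
- exact: partialD.
- exact: F1c.
- by move=> ? ?; exact: partial_comm.
Qed.

Lemma poly3_actD p q w : poly3_act (p + q) w = poly3_act p w + poly3_act q w.
Proof. exact: polyactD. Qed.

Lemma poly3_actC (c : C) w : poly3_act c%:P%:P%:P w = c *: w.
Proof.
apply: etrans (polyactC _ F2D _ _) _; apply: etrans (polyactC _ F1D _ _) _.
exact: (polyactC _ F0D).
Qed.

Lemma poly3_actZ c p w : poly3_act (c *: p) w = c *: poly3_act p w.
Proof.
have ZD : {morph (fun w : W => c *: w) : x y / x + y} by move=> x y; exact: scalerDr.
rewrite [c *: p]/(c%:P%:P%:P * p).
apply: polyactCM_additive => //; [exact: scaler0|] => d v.
apply: polyactCM_additive => //; [exact: scaler0|] => e v'.
by apply: polyactCM_additive => //; [exact: scaler0|] => f v''; rewrite scalerA.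
Qed.

Let iter_partial_comm i j n (w : W) : smooth w ->
  iter n (partial i) (partial j w) = partial j (iter n (partial i) w).
Proof.
move=> sw; elim: n => //= n ->; apply: partial_comm.
exact: (iter_closed _ (@smooth_partial R i) sw).
Qed.

Lemma poly3_act_comm i p w : smooth w ->
  partial i (poly3_act p w) = poly3_act p (partial i w).
Proof.
apply: (@polyact_comm _ _ F2 (partial 2) (@smooth R) _ _ _ _ (partial i) p w).
- exact: smooth0.
- exact: smoothD.
- exact: F2s.
- exact: smooth_partial.
- exact: partial0.
- exact: partialD.
- exact: F2c.
- by move=> ? ?; exact: partial_comm.
Qed.

Lemma poly3_act_smooth p w : smooth w -> smooth (poly3_act p w).
Proof.
by apply: polyact_closed; [exact: smooth0 | exact: smoothD | exact: F2s | exact: smooth_partial].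
Qed.

(** The derivative is first moved onto [w]. A variable of an inner ring acts at the level of
    coefficients, behind the outer derivatives, so it is matched by commuting partial derivatives on
    smooth functions. *)
Lemma poly3_act_var i p w : smooth w ->
  poly3_act (poly3_var i * p) w = partial i (poly3_act p w).
Proof.
move=> sw; rewrite poly3_act_comm //.
have it n j : smooth (iter n (partial j) w).
  exact: (iter_closed _ (@smooth_partial R j) sw).
case: i => [[|[|[|//]]] lti] /=; rewrite /poly3_var /=.
- have -> : Ordinal lti = 0 by exact: val_inj.
  apply: (polyactCM (F := F2) F2D) => n d; rewrite iter_partial_comm //.
  have sw' := it n 2; move: (iter n _ w) sw' => {it sw n p}w sw; move: d => p.
  apply: (polyactCM (F := F1) F1D) => n d; rewrite iter_partial_comm //.
  exact: (polyactXM _ F0D).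
- have -> : Ordinal lti = 1 by exact: val_inj.
  apply: (polyactCM (F := F2) F2D) => n d; rewrite iter_partial_comm //.
  exact: (polyactXM _ F1D).
- have -> : Ordinal lti = 2 by exact: val_inj.
  exact: (polyactXM _ F2D).
Qed.

Definition poly3_pd (T : Type) (i : 'I_3) (u : T -> poly3) : T -> poly3 :=
  fun t => poly3_var i * u t.

(* An operator identity natural in [(V, pd)] follows from the identity for the
   symbols at all real [xi]: by naturality it suffices to prove it for the generic
   spinor, whose components are unknowns over the polynomial ring in the [pd i],
   and there it can be checked by evaluation. *)
Lemma operator_eq0_of_symbol k l
    (Op : forall V : lmodType C, ('I_3 -> V -> V) -> spinor V k -> spinor V l)
    (phi : spinor W k) :
  (forall (V V' : lmodType C) pd pd' (j : {linear V -> V'}),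
     (forall i f, j (pd i f) = pd' i (j f)) ->
     forall psi, map_spinor j (Op V pd psi) = Op V' pd' (map_spinor j psi)) ->
  (forall xi : 'rV[R]_3, xi != 0 -> forall psi, Op C^o (xi_mul xi) psi = 0) ->
  (forall A, smooth (phi A)) -> Op W (@partial R) phi = 0.
Proof.
move=> Op_nat Op_symb sphi; pose T := k.-tuple 'I_2; pose U := T -> poly3.
(* The component of [gen] at [A] is the basis vector with index [A] of the free module [U]. *)
pose gen : spinor U k := [ffun A => fun B : T => (A == B)%:R%:P%:P%:P].
have gen0 : Op U (@poly3_pd T) gen = 0.
  apply/ffunP => A; rewrite [RHS]ffunE; apply/funext => B; apply: poly3_eval_eq0 => x y z.
  (* Evaluation of one coordinate at an integer point turns multiplication by the variables into
     [xi_mul], so the symbol identity applies. *)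
  pose ev (u : U) : C^o := poly3_eval x.+1 y.+1 z.+1 (u B).
  have ev_lin : linear ev by move=> c u v; rewrite /ev poly3_evalD poly3_evalZ.
  pose evL : {linear U -> C^o} := HB.pack ev (GRing.isLinear.Build _ _ _ _ ev ev_lin).
  have xi0 : covector x.+1 y.+1 z.+1 != 0.
    by apply/eqP => /rowP/(_ 0); rewrite !mxE /= => /eqP; rewrite pnatr_eq0.
  have evpd i u : evL (poly3_pd i u) = xi_mul (covector x.+1 y.+1 z.+1) i (evL u).
    by rewrite /= /ev poly3_evalM poly3_eval_var.
  have := Op_nat _ _ _ _ evL evpd gen; rewrite Op_symb // => /ffunP/(_ A).
  by rewrite !ffunE.
(* The map sending each basis vector to the matching component of [phi]; it takes [gen] to [phi] and
   the variables to partial derivatives. *)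
pose J (u : U) : W := \sum_(B : T) poly3_act (u B) (phi B).
have J_lin : linear J.
  move=> c u v; rewrite /J scaler_sumr -big_split; apply: eq_bigr => B _ /=.
  by rewrite poly3_actD poly3_actZ.
pose JL : {linear U -> W} := HB.pack J (GRing.isLinear.Build _ _ _ _ J J_lin).
have J_pd i u : JL (poly3_pd i u) = partial i (JL u).
  rewrite /= /J.
  have [_ ->] : smooth (\sum_(B : T) poly3_act (u B) (phi B)) /\
      partial i (\sum_(B : T) poly3_act (u B) (phi B)) =
      \sum_(B : T) partial i (poly3_act (u B) (phi B)).
    elim/big_rec2: _ => [|B f g _ [sg eg]]; first by split; [exact: smooth0 | exact: partial0].
    have sB := poly3_act_smooth (u B) (sphi B).
    by split; [exact: smoothD | rewrite partialD // eg].
  by apply: eq_bigr => B _; rewrite poly3_act_var.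
have J_gen : map_spinor JL gen = phi.
  apply/ffunP => A; rewrite ffunE /= /J (bigD1 A) //= ffunE eqxx poly3_actC scale1r.
  rewrite big1 ?addr0 // => B neBA.
  by rewrite eq_sym (negPf neBA) poly3_actC scale0r.
rewrite -J_gen -(Op_nat _ _ _ _ JL J_pd) gen0.
by apply/ffunP => A; rewrite !ffunE linear0.
Qed.

End Universal.

(* k = 2s - 2, so that s ranges over the half-integers s >= 1. *)
Theorem lemma3p3 (R : realType) (k : nat) :
  [/\ [/\ @t_op R k @` Ssections R k `<=` Ssections R k.+2,
          @G_op R k.+2 @` Ssections R k.+2 `<=` Ssections R k.+2
        & @d_op R k @` Ssections R k.+2 `<=` Ssections R k],
      forall phi, Ssections R k phi -> G_op (t_op phi) = 0,
      forall psi, Ssections R k.+2 psi -> d_op (G_op psi) = 0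
    & forall xi : 'rV[R]_3, xi != 0 ->
      [/\ @t_symb R xi k @` Sfibre R k
            = Sfibre R k.+2 `&` [set psi | G_symb xi psi = 0],
          @G_symb R xi k.+2 @` Sfibre R k.+2
            = Sfibre R k.+2 `&` [set psi | d_symb xi psi = 0]
        & @d_symb R xi k @` Sfibre R k.+2 `<=` Sfibre R k]].
Proof.
split.
- split=> _ [phi [sphi smphi] <-]; split.
  + exact: twistor_sym.
  + exact: (twistor_closed (@smooth0 R) (@smoothD R) (@smoothZ R) (@smooth_partial R)).
  + exact: calG_sym.
  + exact: (calG_closed (@smooth0 R) (@smoothD R) (@smoothZ R) (@smooth_partial R)).
  + exact: divergence_sym.
  + exact: (divergence_closed (@smooth0 R) (@smoothD R) (@smoothZ R) (@smooth_partial R)).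
- move=> phi [_ smphi].
  apply: (operator_eq0_of_symbol (Op := fun V pd phi => calG pd (twistor pd phi))) smphi.
  + by move=> V V' pd pd' j j_pd psi; rewrite (calG_natural j_pd) (twistor_natural j_pd).
  + by move=> xi /xi_sq_root[r r0 r2] psi; exact: (calG_twistor_symb r0 r2).
(* The transfer principle needs an operator whose symbol vanishes on all spinors, whereas the symbol
   identity holds on symmetric ones; hence the inserted [symmetrize], which fixes [psi]. *)
- move=> psi [spsi smpsi]; rewrite -(symmetrize_id spsi).
  apply: (operator_eq0_of_symbol
    (Op := fun V pd phi => divergence pd (calG pd (symmetrize phi)))) smpsi.
  + move=> V V' pd pd' j j_pd phi.
    by rewrite (divergence_natural j_pd) (calG_natural j_pd) symmetrize_natural.
  + move=> xi /xi_sq_root[r r0 r2] phi.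
    by apply: (divergence_calG_symb r0 r2); exact: symmetrize_sym.
- move=> xi /xi_sq_root[r r0 r2]; split.
  + apply/seteqP; split=> [_ [phi sphi <-]|psi [spsi G0]].
      by split; [exact: twistor_sym | exact: (calG_twistor_symb r0 r2)].
    by have [phi sphi <-] := ker_calG_symb r0 r2 spsi G0; exists phi.
  + apply/seteqP; split=> [_ [phi sphi <-]|psi [spsi d0]].
      by split; [exact: calG_sym | exact: (divergence_calG_symb r0 r2)].
    by have [phi sphi <-] := ker_divergence_symb r0 r2 spsi d0; exists phi.
  + by move=> _ [phi sphi <-]; exact: divergence_sym.
Qed.
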